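(* Let $1<p\le\infty$, let $\Gamma$ be a finitely generated torsion-free nilpotent group with a Mal'cev basis $(a_1,\dots,a_m)$ and corresponding canonical homomorphism $\alpha:\Gamma\to\mathbb{Z}$, and suppose that $[\sigma]\in H^2(\Gamma)$ is a non-torsion cohomology class that is skinny with respect to $\alpha$. Then $\Gamma$ is not $p$-stable. More precisely, let $\sigma$ be a 2-cocycle representing $[\sigma]$ for which there is a polynomial $q\in\mathbb{Q}[x_1,\dots,x_m,y_1]$ with $\sigma(x,y)=q(x_1,\dots,x_m,y_1)$ for all $x,y\in\Gamma$, and for each positive integer $n$ coprime to the denominators of the coefficients of $q$ let $\rho_n:\Gamma\to U(\ell^2(\mathbb{Z}/n\mathbb{Z}))$ be defined by $$\rho_n(x)\delta_{\bar j}=\exp\left(\frac{2\pi i}{n}q(x_1,\dots,x_m,j)\right)\delta_{\bar j+\bar x_1}\qquad (j\in\mathbb{Z}).$$ Then the sequence $(\rho_n)$, indexed by the positive integers $n$ coprime to the denominators of the coefficients of $q$, is a $p$-asymptotic representation of $\Gamma$ that is not $p$-perturbable to a genuine representation.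
   Context: Stability: let $U(k)$ be the group of $k\times k$ complex unitary matrices. For $1\le p<\infty$, $\|M\|_p=(\operatorname{Tr}((M^*M)^{p/2}))^{1/p}$ is the unnormalized Schatten $p$-norm, and $\|M\|_\infty$ is the operator norm. A $p$-asymptotic representation of a countable discrete group $\Gamma$ is a sequence of functions $\rho_n:\Gamma\to U(k_n)$ such that for all $x,y\in\Gamma$, $\|\rho_n(xy)-\rho_n(x)\rho_n(y)\|_p\to 0$. It is $p$-perturbable to a genuine representation if there is a sequence of unitary representations $\tilde\rho_n:\Gamma\to U(k_n)$ such that $\|\tilde\rho_n(x)-\rho_n(x)\|_p\to 0$ for all $x\in\Gamma$. $\Gamma$ is $p$-stable if every $p$-asymptotic representation of $\Gamma$ is $p$-perturbable to a genuine representation. Nilpotent groups: a Mal'cev basis of a torsion-free finitely generated nilpotent group $\Gamma$ is a tuple $(a_1,\dots,a_m)\in\Gamma^m$ such that every $g\in\Gamma$ can be written uniquely as $g=a_1^{x_1}\cdots a_m^{x_m}$ with $(x_1,\dots,x_m)\in\mathbb{Z}^m$, and the subgroups $\Gamma_i=\langle a_i,\dots,a_m\rangle$ form a central series for $\Gamma$ (i.e. $[\Gamma,\Gamma_i]\subseteq\Gamma_{i+1}$, with $\Gamma_{m+1}=\{e\}$). Elements $x\in\Gamma$ are identified with their exponent tuples $(x_1,\dots,x_m)$. The canonical homomorphism is $\alpha(x)=x_1$. Cohomology: $H^2(\Gamma)$ is group cohomology with trivial coefficients $\mathbb{Z}$; a 2-cocycle is a function $\sigma:\Gamma\times\Gamma\to\mathbb{Z}$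 with $\sigma(y,z)-\sigma(xy,z)+\sigma(x,yz)-\sigma(x,y)=0$ for all $x,y,z$. A class $[\sigma]\in H^2(\Gamma)$ is skinny with respect to $\alpha\in\operatorname{Hom}(\Gamma,\mathbb{Z})$ if its restriction to $\ker(\alpha)$ is zero in $H^2(\ker(\alpha))$. Every class skinny with respect to the canonical homomorphism has a cocycle representative of the polynomial form in the claim. Here $\bar j$ is the reduction of $j$ mod $n$, and $\delta_{\bar j}\in\ell^2(\mathbb{Z}/n\mathbb{Z})$ is the standard basis vector; $U(\ell^2(\mathbb{Z}/n\mathbb{Z}))$ is identified with $U(n)$. The maps $\rho_n$ are well defined. *)

(* Defs.v *)
From HB Require Import structures.
From mathcomp Require Import all_boot all_order all_algebra.
From mathcomp Require Import all_classical all_reals all_analysis.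
From mathcomp Require Import complex.
(* Not imported: its notations clash with those of mathcomp-analysis. *)
From mathcomp Require mpoly.

Set Implicit Arguments.
Unset Strict Implicit.
Unset Printing Implicit Defensive.

Import Order.TTheory GRing.Theory Num.Theory.
Import numFieldNormedType.Exports.

Local Open Scope classical_set_scope.
Local Open Scope ring_scope.
Local Open Scope complex_scope.
Local Open Scope sesquilinear_scope.

Section Groups.
Variable G : groupType.
Implicit Types (A B : set G) (x y : G).

Definition is_subgroup A : Prop :=
  [/\ A 1%g, forall x y, A x -> A y -> A (x * y)%g & forall x, A x -> A x^-1%g].

Definition generated A : set G := smallest is_subgroup A.

Definition commutator_subgroup A B : set G :=
  generated [set z | exists x y, [/\ A x, B y & z = [~ x, y]%g]].

Definition finitely_generated : Prop :=
  exists s : seq G, generated [set` s] = [set: G].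

Definition torsion_free : Prop :=
  forall x n, (0 < n)%N -> (x ^+ n)%g = 1%g -> x = 1%g.

Fixpoint lower_central (n : nat) : set G :=
  if n is k.+1 then commutator_subgroup [set: G] (lower_central k)
  else [set: G].

Definition nilpotent_group : Prop := exists n, lower_central n = [set 1%g].

Definition zexpg x (z : int) : G :=
  match z with Posz n => (x ^+ n)%g | Negz n => (x ^- n.+1)%g end.

End Groups.

(* A Mal'cev basis (a_1, ..., a_m) is indexed from 0, and has m.+1 elements:
   the canonical homomorphism needs a first coordinate. *)
Section Malcev.
Variables (G : groupType) (m : nat) (a : 'I_m.+1 -> G).

Definition malcev_word (x : {ffun 'I_m.+1 -> int}) : G :=
  (\prod_(i < m.+1) zexpg (a i) (x i))%g.

(* [malcev_sub i] is the subgroup generated by the a_j with j >= i; it is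
   trivial for i = m.+1. *)
Definition malcev_sub (i : nat) : set G :=
  generated [set g | exists2 j : 'I_m.+1, (i <= j)%N & g = a j].

Definition malcev_basis : Prop :=
  (forall g : G, exists! x : {ffun 'I_m.+1 -> int}, g = malcev_word x) /\
  (forall i : nat, (i < m.+1)%N ->
     commutator_subgroup [set: G] (malcev_sub i) `<=` malcev_sub i.+1).

Definition malcev_coord (g : G) : {ffun 'I_m.+1 -> int} :=
  xget [ffun=> 0] [set x | g = malcev_word x].

Definition canonical_hom (g : G) : int := malcev_coord g ord0.

End Malcev.

(* Classes in H^2(G; Z), with trivial action, are handled through
   representing cocycles. *)
Section Cohomology.
Variable G : groupType.
Implicit Types (s t : G -> G -> int).

Definition cocycle2 s : Prop := forall x y z : G,
  s y z - s (x * y)%g z + s x (y * z)%g - s x y = 0.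

(* The restriction of [s] to the subgroup [H] is a coboundary on [H]; the
   values of the cochain [f] outside of [H] are irrelevant. *)
Definition coboundary2_on (H : set G) s : Prop :=
  exists f : G -> int, forall x y : G, H x -> H y ->
    s x y = f y - f (x * y)%g + f x.

Definition cohomologous s t : Prop :=
  coboundary2_on [set: G] (fun x y => s x y - t x y).

Definition torsion_class s : Prop :=
  exists2 n : nat, (0 < n)%N & coboundary2_on [set: G] (fun x y => s x y *+ n).

Definition skinny (alpha : G -> int) s : Prop :=
  coboundary2_on [set x | alpha x = 0] s.

End Cohomology.

Section Schatten.
Variables (R : realType) (k : nat).
Implicit Types (A M : 'M[R[i]]_k).

(* A ^ s for a positive semidefinite A, by the spectral theorem. *)
Definition psd_power A (s : R) : 'M[R[i]]_k :=
  invmx (spectralmx A) *m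
  diag_mx (map_mx (fun z : R[i] => (complex.Re z `^ s)%:C) (spectral_diag A)) *m
  spectralmx A.

Definition l2norm (v : 'cV[R[i]]_k) : R :=
  Num.sqrt (\sum_i ((complex.Re (v i 0)) ^+ 2 + (complex.Im (v i 0)) ^+ 2)).

Definition operator_norm M : R :=
  sup [set l2norm (M *m v) | v in [set v : 'cV[R[i]]_k | l2norm v <= 1]].

(* Only meaningful for 1 <= p. *)
Definition schatten_norm (p : \bar R) M : R :=
  match p with
  | r%:E => (complex.Re (\tr (psd_power (M ^t* *m M) (r / 2)))) `^ r^-1
  | +oo%E => operator_norm M
  | -oo%E => 0
  end.

End Schatten.

(* Sequences of maps into U(k n) are indexed by the n in a set N of naturals,
   and limits are taken as n tends to infinity within N; the values at n
   outside of N are irrelevant. *)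
Section Stability.
Variables (R : realType) (p : \bar R) (G : groupType).

Definition asymptotic_rep (N : set nat) (k : nat -> nat)
    (rho : forall n, G -> 'M[R[i]]_(k n)) : Prop :=
  (forall n, N n -> forall x, rho n x \is unitarymx) /\
  (forall x y, schatten_norm p (rho n (x * y)%g - rho n x *m rho n y)
     @[n --> within N \oo] --> (0 : R)).

Definition unitary_rep (d : nat) (pi : G -> 'M[R[i]]_d) : Prop :=
  (forall x, pi x \is unitarymx) /\
  (forall x y, pi (x * y)%g = pi x *m pi y).

Definition perturbable (N : set nat) (k : nat -> nat)
    (rho : forall n, G -> 'M[R[i]]_(k n)) : Prop :=
  exists2 rho' : forall n, G -> 'M[R[i]]_(k n),
    forall n, N n -> unitary_rep (rho' n) &
    forall x, schatten_norm p (rho' n x - rho n x)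
      @[n --> within N \oo] --> (0 : R).

Definition stable : Prop :=
  forall (k : nat -> nat) (rho : forall n, G -> 'M[R[i]]_(k n)),
    asymptotic_rep [set: nat] rho -> perturbable [set: nat] rho.

End Stability.

(* Polynomials in x_1, ..., x_m, y_1: the last variable is y_1. *)
Definition poly_eval (m : nat) (q : mpoly.mpoly m.+1 rat)
    (x : 'I_m -> int) (y : int) : rat :=
  mpoly.meval
    (fun i => (if unlift ord_max i is Some l then x l else y)%:~R) q.

Definition coprime_to_denominators (m : nat) (q : mpoly.mpoly m rat) : set nat :=
  [set n | (0 < n)%N /\ forall mu, coprime n `|denq (mpoly.mcoeff mu q)|%N].

Definition expi (R : realType) (t : R) : R[i] := cos t +i* sin t.

(* The matrix, acting on column vectors, of the operator on l^2(Z/nZ) sending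
   delta_j to exp (2 i pi q(x, j) / n) delta_(j + x_1), for j = 0, ..., n - 1;
   [rho_seq_delta] below shows that the formula then holds for all integers
   j. *)
Definition rho_seq (R : realType) (G : groupType) (m : nat) (a : 'I_m.+1 -> G)
    (q : mpoly.mpoly m.+2 rat) (n : nat) (x : G) : 'M[R[i]]_n :=
  \matrix_(i, j)
    if (i%:Z == j%:Z + malcev_coord a x ord0 %[mod n%:Z])%Z
    then expi (2 * pi / n%:R * ratr (poly_eval q (malcev_coord a x) j%:Z))
    else 0.

Definition delta_mod (R : realType) (n : nat) (j : int) : 'cV[R[i]]_n :=
  \col_i ((i%:Z == j %[mod n%:Z])%Z)%:R.

Lemma expiDZ (R : realType) (t : R) (z : int) :
  expi (t + 2 * pi * z%:~R) = expi t.
Proof.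
have H (s : R) (n : nat) : expi (s + 2 * pi * n%:R) = expi s.
  have -> : 2 * pi * n%:R = (pi *+ 2) *+ n :> R.
    by rewrite mulr_natl mulr_natr.
  by rewrite /expi (periodicn (@cosD2pi R)) (periodicn (@sinD2pi R)).
case: z => n; first exact: H.
by rewrite NegzE mulrNz mulrN -(H _ n.+1) subrK.
Qed.

Lemma malcev_coordK (G : groupType) (m : nat) (a : 'I_m.+1 -> G) x :
  malcev_basis a -> malcev_coord a (malcev_word a x) = x.
Proof.
move=> [h _]; have [y [hy uy]] := h (malcev_word a x).
rewrite /malcev_coord; apply: xget_unique => //= z hz.
by rewrite -(uy x) // (uy z).
Qed.

Lemma poly_eval_int (G : groupType) (m : nat) (a : 'I_m.+1 -> G)
    (s : G -> G -> int) (q : mpoly.mpoly m.+2 rat) (x : G) (j : int) :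
  malcev_basis a ->
  (forall x y, (s x y)%:~R = poly_eval q (malcev_coord a x) (canonical_hom a y)) ->
  exists z : int, poly_eval q (malcev_coord a x) j = z%:~R.
Proof.
move=> ha hs; exists (s x (malcev_word a [ffun=> j])).
by rewrite hs /canonical_hom malcev_coordK // ffunE.
Qed.

Lemma poly_eval_mod (m n : nat) (q : mpoly.mpoly m.+1 rat) (x : 'I_m -> int)
    (j j' : int) : coprime_to_denominators q n -> (j = j' %[mod n%:Z])%Z ->
  exists (D : nat) (c : int), coprime n D /\
    D%:R * (poly_eval q x j - poly_eval q x j') = n%:R * c%:~R.
Proof.
move=> [n0 hn] hj; rewrite /poly_eval !mpoly.mevalE -sumrB.
apply: (big_ind (fun r : rat => exists (D : nat) (c : int), coprime n D /\
    D%:R * r = n%:R * c%:~R)).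
- by exists 1%N, 0; rewrite coprimen1 !mulr0.
- move=> r1 r2 [D1 [c1 [h1 e1]]] [D2 [c2 [h2 e2]]].
  exists (D1 * D2)%N, (D2%:Z * c1 + D1%:Z * c2); split.
    by rewrite coprimeMr h1.
  rewrite natrM (_ : (D2%:Z * c1 + _)%:~R = D2%:R * c1%:~R + D1%:R * c2%:~R).
    rewrite !mulrDr -(mulrA D1%:R) (mulrCA D1%:R) e1.
    by rewrite -(mulrA D1%:R) e2 !(mulrCA n%:R).
  by rewrite rmorphD !rmorphM.
move=> mu _; set c := mpoly.mcoeff mu q.
pose v (y : int) i := if unlift (@ord_max m) i is Some l then x l else y.
pose P y : int := \prod_i v y i ^+ mpoly.fun_of_multinom mu i.
have EP y : \prod_i ((v y i)%:~R : rat) ^+ mpoly.fun_of_multinom mu i = (P y)%:~R.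
  by rewrite rmorph_prod; apply: eq_bigr => i _; rewrite rmorphXn.
rewrite (EP j) (EP j') -mulrBr -rmorphB /=.
have /dvdzP[e he] : (n%:Z %| P j - P j')%Z.
  rewrite -eqz_mod_dvd; apply/eqP.
  apply: (big_ind2 (fun u w : int => (u = w %[mod n%:Z])%Z)) => //.
    by move=> u u' w w' h h'; rewrite -modzMm h h' modzMm.
  move=> i _; rewrite -modzXm /v; case: unlift => [l|]; last by rewrite hj modzXm.
  by rewrite modzXm.
exists `|denq c|%N, (numq c * e); split; first exact: hn.
rewrite he -[X in _ * (X * _)]divq_num_den !rmorphM /= -!pmulrn natr_absz.
rewrite gtr0_norm ?denq_gt0 // mulrA [_ * (_ / _)]mulrC divfK ?intr_eq0 ?denq_neq0 //.
by rewrite [RHS]mulrC mulrA.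
Qed.

Lemma rho_seq_delta (R : realType) (G : groupType) (m : nat) (a : 'I_m.+1 -> G)
    (s : G -> G -> int) (q : mpoly.mpoly m.+2 rat) (n : nat) (x : G) (j : int) :
  malcev_basis a ->
  (forall x y, (s x y)%:~R = poly_eval q (malcev_coord a x) (canonical_hom a y)) ->
  coprime_to_denominators q n ->
  rho_seq R a q n x *m delta_mod R n j =
  expi (2 * pi / n%:R * ratr (poly_eval q (malcev_coord a x) j)) *:
    delta_mod R n (j + malcev_coord a x ord0).
Proof.
move=> ha hs hn; have [n0 _] := hn.
have nZ : n%:Z != 0 by rewrite eqz_nat -lt0n.
have [j0 hj0] : exists j0 : 'I_n, (j0%:Z = j %[mod n%:Z])%Z.
  have lt : (`|(j %% n%:Z)%Z|%N < n)%N.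
    by rewrite -ltz_nat gez0_abs ?modz_ge0 // ltz_pmod.
  by exists (Ordinal lt); rewrite /= gez0_abs ?modz_ge0 // modz_mod.
apply/colP => i; rewrite !mxE (bigD1 j0) //= big1 ?addr0; last first.
  move=> l lj; rewrite !mxE (_ : (l%:Z == j %[mod n%:Z])%Z = false) ?mulr0 //.
  apply/eqP => e; case/eqP: lj; apply: val_inj; move: e; rewrite -hj0 !modz_small.
  - by case.
  - by rewrite ltz_nat ltn_ord.
  - by rewrite ltz_nat ltn_ord.
rewrite !mxE hj0 eqxx mulr1.
rewrite -[in X in if X then _ else _]modzDml hj0 modzDml.
case: eqP => _; last by rewrite mulr0.
rewrite mulr1.
have [D [c [cD eD]]] := poly_eval_mod (malcev_coord a x) hn hj0.
have [z ez] := poly_eval_int x j ha hs.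
have [z0 ez0] := poly_eval_int x j0%:Z ha hs.
rewrite ez ez0 in eD *.
have /dvdzP[e he] : (n%:Z %| z0 - z)%Z.
  have : (n%:Z %| D%:Z * (z0 - z))%Z.
    apply/dvdzP; exists c; apply: (@intr_inj rat).
    by rewrite !rmorphM rmorphB /= -!pmulrn eD mulrC.
  by rewrite Gauss_dvdzr // coprimezE.
rewrite (_ : z0 = z + e * n%:Z); last by rewrite -he addrC subrK.
rewrite !ratr_int rmorphD rmorphM /= mulrDr -[RHS](expiDZ _ e); congr expi.
congr (_ + _); rewrite -!pmulrn mulrCA.
by rewrite [X in _ * X]mulfVK ?pnatr_eq0 -?lt0n // mulrC.
Qed.

(* Main.v *)
(* The operators rho_n(x) form a projective representation with multiplier
   exp(2 pi i tau(x, y) / n), which gives the asymptotic part, since the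
   Schatten p-norm of the identity of C^n is n^(1/p) = o(n) for p > 1.

   Suppose that genuine representations rho'_n are close to rho_n, and put
   W(x) = rho'_n(x) rho_n(x)^*, a unitary near 1 in operator norm.  Then
   W(xy) = W(x) (rho_n(x) W(y) rho_n(x)^* ) exp(2 pi i tau(x, y) / n).
   Let A(W) be the sum of the arguments of the eigenvalues of W.  On a
   neighbourhood of 1 which does not depend on n, A is additive: this holds
   modulo 2 pi because of the determinant, and exactly by continuity along a
   one-parameter group.  As A is invariant under conjugation, A / (2 pi) is a
   real cochain bounding tau on any given finite set of pairs.  For finitely
   generated G these finite linear systems together have a rational solution
   with bounded denominators, so the class of tau is torsion.

   For the failure of stability we need one such family: a skinny class has a
   representative tau(x, y) which depends only on x and alpha(y) and vanishes
   on the powers of t = a_1.  Expanding along iterated commutators with t in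
   binomial coefficients, tau(x, t^j) modulo p depends only on j modulo p when
   p is a prime larger than the nilpotency class. *)

Require Import Defs.
From mathcomp Require Import all_boot all_order all_algebra.
From mathcomp Require Import all_classical all_reals all_analysis.
From mathcomp Require Import complex.
From mathcomp Require Import ring lra.
From mathcomp Require mpoly.

Set Implicit Arguments.
Unset Strict Implicit.
Unset Printing Implicit Defensive.

Import Order.TTheory GRing.Theory Num.Theory.
Import numFieldNormedType.Exports.

Local Open Scope classical_set_scope.
Local Open Scope ring_scope.
Local Open Scope complex_scope.
Local Open Scope sesquilinear_scope.

(** * Arguments of complex numbers of modulus one *)

Section Angles.
Variable R : realType.
Implicit Types (s t : R) (z w : R[i]).

(** The squared modulus, valued in [R]. All estimates are made on squares, so no square roots occur;
    the price is a factor 2 in each triangle inequality. *)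
Definition snorm z : R := (complex.Re z) ^+ 2 + (complex.Im z) ^+ 2.

Lemma snormE z : (snorm z)%:C = z * (z^*)%R.
Proof. by rewrite /snorm add_Re2_Im2 normCK. Qed.

Lemma snorm_ge0 z : 0 <= snorm z.
Proof. by rewrite addr_ge0 ?sqr_ge0. Qed.

Lemma snormM z w : snorm (z * w) = snorm z * snorm w.
Proof. by case: z w => [a b] [c d]; rewrite /snorm /=; ring. Qed.

Lemma snorm0 : snorm 0 = 0.
Proof. by rewrite /snorm /= expr0n addr0. Qed.

Lemma snorm1 : snorm 1 = 1.
Proof. by rewrite /snorm /= expr1n expr0n addr0. Qed.

Lemma snormN z : snorm (- z) = snorm z.
Proof. by case: z => a b; rewrite /snorm /= !sqrrN. Qed.

Lemma snorm_conj z : snorm (z^*)%R = snorm z.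
Proof. by case: z => a b; rewrite /snorm /= sqrrN. Qed.

Lemma snormD_le z w : snorm (z + w) <= 2 * snorm z + 2 * snorm w.
Proof.
case: z w => [a b] [c d]; rewrite /snorm /= -subr_ge0.
have -> : 2 * (a ^+ 2 + b ^+ 2) + 2 * (c ^+ 2 + d ^+ 2) -
  ((a + c) ^+ 2 + (b + d) ^+ 2) = (a - c) ^+ 2 + (b - d) ^+ 2 by ring.
by rewrite addr_ge0 ?sqr_ge0.
Qed.

Lemma snorm_expi t : snorm (expi t) = 1.
Proof. exact: cos2Dsin2. Qed.

Lemma expi0 : expi (0 : R) = 1.
Proof. by rewrite /expi cos0 sin0. Qed.

Lemma expiD s t : expi (s + t) = expi s * expi t.
Proof. by rewrite /expi cosD sinD; simpc; congr (_ +i* _); ring. Qed.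

Lemma expi_sum I (r : seq I) (F : I -> R) :
  expi (\sum_(i <- r) F i) = \prod_(i <- r) expi (F i).
Proof. by apply: (big_morph (@expi R) expiD expi0). Qed.

Lemma sin_MVT s t : s <= t ->
  exists2 c, c \in `[s, t] & sin t - sin s = cos c * (t - s).
Proof.
move=> st; apply: MVT_segment => //.
by apply: continuous_subspaceT; exact: continuous_sin.
Qed.

Lemma sin_le_id s : `|sin s| <= `|s|.
Proof.
wlog s0 : s / 0 <= s.
  move=> h; have [/h//|/ltW {}s0] := leP 0 s.
  by rewrite -normrN -sinN -(normrN s); apply: h; rewrite oppr_ge0.
have [c _] := sin_MVT s0.
rewrite sin0 !subr0 => ->; rewrite normrM ler_piMl //; exact: cos_max.
Qed.

(** A chord of angle t has squared length 4 sin(t/2)^2, and |sin s| <= |s|. *)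
Lemma snorm_expiB1 t : snorm (expi t - 1) <= t ^+ 2.
Proof.
have -> : snorm (expi t - 1) = 4 * sin (t / 2) ^+ 2.
  have e : t = (t / 2) *+ 2 by rewrite -mulr_natr divfK.
  rewrite /snorm /= subr0 [in LHS]e cos_mulr2n sin_mulr2n.
  have := cos2Dsin2 (t / 2); move: (cos (t / 2)) (sin (t / 2)) => c s h.
  have -> : c ^+ 2 = 1 - s ^+ 2 by rewrite -h addrK.
  have -> : ((c * s) *+ 2) ^+ 2 = 4 * c ^+ 2 * s ^+ 2 by ring.
  have -> : c ^+ 2 = 1 - s ^+ 2 by rewrite -h addrK.
  ring.
have : sin (t / 2) ^+ 2 <= (t / 2) ^+ 2.
  by rewrite -ler_sqrt ?sqr_ge0 // !sqrtr_sqr sin_le_id.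
by rewrite exprMn; lra.
Qed.

(** cos t = 1 forces sin(t/2) = 0, while the sine has no zero in the open interval from -pi to pi
    other than 0. *)
Lemma expi_eq1 t : expi t = 1 -> `|t| < 2 * pi -> t = 0.
Proof.
move=> [c _].
have s0 : sin (t / 2) = 0.
  have e : t = (t / 2) *+ 2 by rewrite -mulr_natr divfK.
  have : cos ((t / 2) *+ 2) = 1 by rewrite -e.
  rewrite cos_mulr2n cos2sin2 => {}c.
  by apply/eqP; rewrite -sqrf_eq0; apply/eqP; lra.
rewrite ltr_norml => /andP[h1 h2]; apply/eqP; move: s0; apply: contra_eqT.
rewrite neq_lt => /orP[t0|t0]; last first.
  by rewrite gt_eqF // sin_gt0_pi //; lra.
rewrite -oppr_eq0 -sinN gt_eqF // sin_gt0_pi //; lra.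
Qed.

(** The angles at most pi/3 in absolute value. On this arc [asin] of the imaginary part is the
    argument, and the sine has slope bounded away from 0. *)
Definition arc z := snorm z = 1 /\ 1 / 2 <= complex.Re z.

Definition arg z : R := asin (complex.Im z).

Lemma arc_near1 z : snorm z = 1 -> snorm (z - 1) <= 1 -> arc z.
Proof.
move=> h1 h2; split=> //; move: h1 h2; case: z => a b; rewrite /snorm /=.
by rewrite subr0 => h1; rewrite sqrrB expr1n mulr1; lra.
Qed.

Lemma arc_Im z : arc z -> -1 <= complex.Im z <= 1.
Proof.
case: z => a b [/= h1 h2]; move: h1; rewrite /snorm /= => h3.
by apply/andP; split; nra.
Qed.

Lemma expi_arg z : arc z -> expi (arg z) = z.
Proof.
move=> az; have hz := arc_Im az; move: az hz.
case: z => a b [h1 h2]; rewrite /snorm /arg /= in h1 h2 * => hb.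
rewrite /expi asinK ?in_itv //= cos_asin //; congr (_ +i* _).
rewrite (_ : 1 - b ^+ 2 = a ^+ 2); last by lra.
by rewrite sqrtr_sqr ger0_norm //; lra.
Qed.

Lemma arg_range z : arc z -> - (pi / 2) <= arg z <= pi / 2.
Proof.
by move=> /arc_Im h; rewrite asin_geNpi2 ?asin_lepi2.
Qed.

Lemma arg_expi t : - (pi / 2) <= t <= pi / 2 -> arg (expi t) = t.
Proof. by move=> h; rewrite /arg /= sinK ?in_itv. Qed.

(** By the mean value theorem the imaginary parts differ by cos c times the difference of the
    arguments, with c between them. On the arc imaginary parts are at most sqrt 3 / 2 <= 7/8 in
    absolute value, so cos c >= 2/5, and (5/2)^2 <= 7. *)
Lemma arg_lip z w : arc z -> arc w ->
  (arg z - arg w) ^+ 2 <= 7 * snorm (z - w).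
Proof.
wlog le : z w / arg w <= arg z.
  move=> h az aw; have [/h|/ltW/h] := leP (arg w) (arg z); first exact.
  by rewrite -snormN opprB -sqrrN opprB; apply.
move=> az aw.
have [c] := sin_MVT le.
rewrite in_itv /= => /andP[c1 c2] e.
have /andP[z1 z2] := arg_range az; have /andP[w1 w2] := arg_range aw.
have cr : - (pi / 2) <= c <= pi / 2 by apply/andP; split; lra.
have cc : 2 / 5 <= cos c.
  have c0 := cos_ge0_pihalf cr.
  have s1 : sin (arg w) <= sin c.
    by rewrite leNgt ltr_sin ?in_itv -?leNgt //=; apply/andP.
  have s2 : sin c <= sin (arg z).
    by rewrite leNgt ltr_sin ?in_itv -?leNgt //=; apply/andP.
  have e1 := cos2Dsin2 c.
  move: s1 s2; rewrite -[sin (arg w)]/(complex.Im (expi (arg w))).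
  rewrite -[sin (arg z)]/(complex.Im (expi (arg z))) !expi_arg //.
  case: az aw; rewrite /snorm => z3 z4 [w3 w4] s1 s2.
  have bnd (x y : R) : x ^+ 2 + y ^+ 2 = 1 -> 1 / 2 <= x -> `|y| <= 7 / 8.
    by move=> h1 h2; rewrite ler_norml; apply/andP; split; nra.
  move: (bnd _ _ z3 z4) (bnd _ _ w3 w4); rewrite !ler_norml.
  move=> /andP[_ y1] /andP[y2 _].
  have {}s1 := le_trans y2 s1; have {}s2 := le_trans s2 y1.
  move: (sin c) (cos c) c0 e1 s1 s2 => s x; clear; nra.
have e' : complex.Im z - complex.Im w = cos c * (arg z - arg w).
  by rewrite -e -[in LHS](expi_arg az) -[in LHS](expi_arg aw).
have : (arg z - arg w) ^+ 2 <= 7 * (complex.Im z - complex.Im w) ^+ 2.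
  rewrite e'; move: (arg z - arg w) (cos c) cc => x y h.
  rewrite exprMn mulrA ler_peMl ?sqr_ge0 //; nra.
case: (z) (w) => [a b] [a' b'] /= h; rewrite /snorm /=.
by have := sqr_ge0 (a - a'); lra.
Qed.

End Angles.

(** * Additivity of the sum of the arguments of the eigenvalues *)

Section OperatorBounds.
Variable R : realType.
Implicit Types (c : R) (n : nat).

Definition vnorm m (v : 'cV[R[i]]_m) : R := \sum_i snorm (v i 0).

(** Here [c] bounds the square of the operator norm; likewise [near1 c] below bounds a squared
    distance to the identity. *)
Definition opb c m n (M : 'M[R[i]]_(m, n)) :=
  forall v : 'cV[R[i]]_n, vnorm (M *m v) <= c * vnorm v.

Lemma vnormE m (v : 'cV[R[i]]_m) : (vnorm v)%:C = (v^t* *m v) 0 0.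
Proof.
rewrite /vnorm !mxE raddf_sum /=; apply: eq_bigr => i _.
by rewrite snormE !mxE mulrC.
Qed.

Lemma vnorm_ge0 m (v : 'cV[R[i]]_m) : 0 <= vnorm v.
Proof. by rewrite sumr_ge0 // => i _; exact: snorm_ge0. Qed.

Lemma snorm_le_vnorm m (v : 'cV[R[i]]_m) i : snorm (v i 0) <= vnorm v.
Proof.
by rewrite /vnorm (bigD1 i) //= lerDl sumr_ge0 // => j _; exact: snorm_ge0.
Qed.

Lemma vnorm_delta m (i : 'I_m) : vnorm (delta_mx i 0) = 1.
Proof.
rewrite /vnorm (bigD1 i) //= big1 => [|j ji]; last first.
  by rewrite mxE (negbTE ji) /= snorm0.
by rewrite mxE !eqxx snorm1 addr0.
Qed.

Lemma vnormZ m z (v : 'cV[R[i]]_m) : vnorm (z *: v) = snorm z * vnorm v.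
Proof.
by rewrite /vnorm mulr_sumr; apply: eq_bigr => i _; rewrite mxE snormM.
Qed.

Lemma vnormD_le m (v w : 'cV[R[i]]_m) :
  vnorm (v + w) <= 2 * vnorm v + 2 * vnorm w.
Proof.
rewrite /vnorm !mulr_sumr -big_split; apply: ler_sum => i _.
by rewrite mxE; exact: snormD_le.
Qed.

Lemma unitarymxC n (U : 'M[R[i]]_n) : U \is unitarymx -> U^t* *m U = 1%:M.
Proof.
by rewrite -trmxC_unitary => /unitarymxP; rewrite trmxCK.
Qed.

Lemma unitaryC n (U : 'M[R[i]]_n) : U \is unitarymx -> U^t* \is unitarymx.
Proof. by rewrite trmxC_unitary. Qed.

Lemma unitaryM n (U V : 'M[R[i]]_n) :
  U \is unitarymx -> V \is unitarymx -> U *m V \is unitarymx.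
Proof. exact: mul_unitarymx. Qed.

Lemma adjM m n p (A : 'M[R[i]]_(m, n)) (B : 'M[R[i]]_(n, p)) :
  (A *m B)^t* = B^t* *m A^t*.
Proof. by rewrite trmx_mul map_mxM. Qed.

Lemma vnorm_unitary n (U : 'M[R[i]]_n) v :
  U \is unitarymx -> vnorm (U *m v) = vnorm v.
Proof.
move=> hU; apply: complexI; rewrite !vnormE adjM -mulmxA (mulmxA _ U).
by rewrite unitarymxC // mul1mx.
Qed.

Lemma opbW c c' m n (M : 'M[R[i]]_(m, n)) : opb c M -> c <= c' -> opb c' M.
Proof.
move=> hM h v; apply: le_trans (hM v) _; apply: ler_wpM2r => //.
exact: vnorm_ge0.
Qed.

Lemma opb0 m n : opb 0 (0 : 'M[R[i]]_(m, n)).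
Proof.
by move=> v; rewrite mul0mx mul0r /vnorm big1 // => i _; rewrite mxE snorm0.
Qed.

Lemma opbD c c' m n (M M' : 'M[R[i]]_(m, n)) :
  opb c M -> opb c' M' -> opb (2 * c + 2 * c') (M + M').
Proof.
move=> h h' v; rewrite mulmxDl; apply: le_trans (vnormD_le _ _) _.
by have := h v; have := h' v; lra.
Qed.

Lemma opb_unitl c m n (U : 'M[R[i]]_m) (M : 'M[R[i]]_(m, n)) :
  U \is unitarymx -> opb c M -> opb c (U *m M).
Proof. by move=> hU h v; rewrite -mulmxA vnorm_unitary. Qed.

Lemma opb_unitr c m n (U : 'M[R[i]]_n) (M : 'M[R[i]]_(m, n)) :
  U \is unitarymx -> opb c M -> opb c (M *m U).
Proof. by move=> hU h v; rewrite -mulmxA -(vnorm_unitary v hU). Qed.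

Lemma opb_entry c m n (M : 'M[R[i]]_(m, n)) i j : opb c M -> snorm (M i j) <= c.
Proof.
move=> h; have := h (delta_mx j 0); rewrite vnorm_delta mulr1; apply: le_trans.
by apply: le_trans (snorm_le_vnorm _ i); rewrite -colE mxE.
Qed.

Lemma opb_diag c n (d : 'rV[R[i]]_n) :
  (forall j, snorm (d 0 j) <= c) -> opb c (diag_mx d).
Proof.
move=> h v; rewrite /vnorm mulr_sumr; apply: ler_sum => i _.
rewrite mul_diag_mx !mxE snormM; apply: ler_wpM2r => //; exact: snorm_ge0.
Qed.

Definition near1 c n (W : 'M[R[i]]_n) := opb c (W - 1%:M).

Lemma near1W c c' n (W : 'M[R[i]]_n) : near1 c W -> c <= c' -> near1 c' W.
Proof. exact: opbW. Qed.

Lemma near1M c c' n (W W' : 'M[R[i]]_n) : W \is unitarymx ->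
  near1 c W -> near1 c' W' -> near1 (2 * c' + 2 * c) (W *m W').
Proof.
move=> hW h h'; rewrite /near1.
have -> : W *m W' - 1%:M = W *m (W' - 1%:M) + (W - 1%:M).
  by rewrite mulmxBr mulmx1 addrA subrK.
exact: opbD (opb_unitl hW h') h.
Qed.

Lemma near1_conj c n (U W : 'M[R[i]]_n) : U \is unitarymx ->
  near1 c W -> near1 c (U *m W *m U^t*).
Proof.
move=> hU h; rewrite /near1.
have -> : U *m W *m U^t* - 1%:M = U *m (W - 1%:M) *m U^t*.
  by rewrite mulmxBr mulmxBl mulmx1 (unitarymxP hU).
exact: opb_unitr (unitaryC hU) (opb_unitl hU h).
Qed.

End OperatorBounds.

(** * Sums of arguments of eigenvalues of unitary matrices near 1 *)

Section ArgumentSum.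
Variable R : realType.
Variable n : nat.
Implicit Types (c : R) (W S U V : 'M[R[i]]_n) (d : 'rV[R[i]]_n).

(** A relation rather than the choice made by [spectralmx]: conjugates, scalars and one-parameter
    groups come with diagonalizations of their own. *)
Definition diagonalizes S d W := S \is unitarymx /\ W = S^t* *m diag_mx d *m S.

Lemma spectral_diagonalizes W : W \is unitarymx ->
  diagonalizes (spectralmx W) (spectral_diag W) W.
Proof.
move=> hW; split; first exact: spectral_unitarymx.
rewrite -invmx_unitary ?spectral_unitarymx //; apply/orthomx_spectralP.
by apply/normalmxP; rewrite (unitarymxP hW) unitarymxC.
Qed.

Lemma diagonalizes_conj S d W U : U \is unitarymx ->
  diagonalizes S d W -> diagonalizes (S *m U^t*) d (U *m W *m U^t*).
Proof.
move=> hU [hS ->]; split; first exact: unitaryM hS (unitaryC hU).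
by rewrite adjM trmxCK !mulmxA.
Qed.

Lemma diagonalizes_eq S d W : diagonalizes S d W ->
  S *m W *m S^t* = diag_mx d.
Proof.
by case=> hS ->; rewrite !mulmxA (unitarymxP hS) mul1mx mulmxtVK.
Qed.

Lemma diagonalizes_sub1 S d W : diagonalizes S d W ->
  diagonalizes S (d - const_mx 1) (W - 1%:M).
Proof.
case=> hS ->; split=> //.
by rewrite linearB /= diag_const_mx mulmxBr mulmxBl mulmx1 unitarymxC.
Qed.

Lemma opb_diagonalizes c S d W : diagonalizes S d W ->
  opb c W <-> (forall j, snorm (d 0 j) <= c).
Proof.
move=> hd; have [hS eW] := hd; split=> [h j|h].
  have : opb c (diag_mx d).
    rewrite -(diagonalizes_eq hd).
    exact: opb_unitr (unitaryC hS) (opb_unitl hS h).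
  by move=> /(opb_entry j j); rewrite mxE eqxx.
by rewrite eW; apply: opb_unitr hS (opb_unitl (unitaryC hS) (opb_diag h)).
Qed.

Lemma near1_diagonalizes c S d W : diagonalizes S d W ->
  near1 c W <-> (forall j, snorm (d 0 j - 1) <= c).
Proof.
move=> /diagonalizes_sub1/(opb_diagonalizes c) h; rewrite /near1 h.
by split=> H j; have := H j; rewrite !mxE.
Qed.

Lemma unitary_diagonalizes S d W : diagonalizes S d W ->
  W \is unitarymx <-> (forall j, snorm (d 0 j) = 1).
Proof.
move=> hd; have [hS eW] := hd.
have E : diag_mx d *m (diag_mx d)^t* = diag_mx (\row_j (snorm (d 0 j))%:C).
  rewrite tr_diag_mx map_diag_mx mulmx_diag; congr diag_mx; apply/rowP => j.
  by rewrite !mxE snormE.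
split=> [hW j|h].
  have : diag_mx d \is unitarymx.
    rewrite -(diagonalizes_eq hd).
    exact: unitaryM (unitaryM hS hW) (unitaryC hS).
  move=> /unitarymxP; rewrite E => /matrixP/(_ j j).
  by rewrite !mxE eqxx !mulr1n => /complexI.
rewrite eW; refine (unitaryM (unitaryM (unitaryC hS) _) hS).
apply/unitarymxP; rewrite E.
by apply/matrixP => i j; rewrite !mxE h.
Qed.

Lemma near1_arc c S d W : diagonalizes S d W -> W \is unitarymx -> c <= 1 ->
  near1 c W -> forall j, arc (d 0 j).
Proof.
move=> hd hW c1 h j; apply: arc_near1.
  exact: ((unitary_diagonalizes hd).1 hW).
exact: le_trans ((near1_diagonalizes c hd).1 h j) c1.
Qed.

Lemma unitary_row_sum U i : U \is unitarymx -> \sum_j snorm (U i j) = 1.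
Proof.
move=> /unitarymxP/matrixP/(_ i i); rewrite !mxE eqxx => h.
apply: complexI; rewrite raddf_sum /= -[RHS]h; apply: eq_bigr => j _.
by rewrite snormE !mxE.
Qed.

Lemma unitary_col_sum U j : U \is unitarymx -> \sum_i snorm (U i j) = 1.
Proof.
rewrite -trmxC_unitary => /(unitary_row_sum j) <-; apply: eq_bigr => i _.
by rewrite !mxE snorm_conj.
Qed.

(* With U = S S'^*, the matrix of the |U_ij|^2 is doubly stochastic, and U
   intertwines the two diagonal matrices up to the small matrix
   S (W - W') S'^*; hence U_ij is small unless d_i and d'_j are close. *)
Lemma sum_arg_close eta S d W S' d' W' :
  diagonalizes S d W -> diagonalizes S' d' W' ->
  (forall j, arc (d 0 j)) -> (forall j, arc (d' 0 j)) ->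
  0 <= eta -> opb (eta ^+ 2) (W - W') ->
  `|\sum_j arg (d 0 j) - \sum_j arg (d' 0 j)| <= n%:R ^+ 2 * (3 * eta).
Proof.
move=> hd hd' ad ad' eta0 h; have [hS eW] := hd; have [hS' eW'] := hd'.
set U := S *m S'^t*.
have hU : U \is unitarymx by exact: unitaryM hS (unitaryC hS').
have E : S *m (W - W') *m S'^t* = diag_mx d *m U - U *m diag_mx d'.
  have e : S *m W = diag_mx d *m S.
    by rewrite -(diagonalizes_eq hd) -[RHS]mulmxA unitarymxC // mulmx1.
  have e' : W' *m S'^t* = S'^t* *m diag_mx d'.
    rewrite -(diagonalizes_eq hd') -[S' *m _ *m _]mulmxA [RHS]mulmxA.
    by rewrite unitarymxC // mul1mx.
  by rewrite mulmxBr mulmxBl e -[S *m W' *m _]mulmxA e' /U !mulmxA.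
have {}E i j : snorm (U i j) * snorm (d 0 i - d' 0 j) <= eta ^+ 2.
  have : opb (eta ^+ 2) (S *m (W - W') *m S'^t*).
    exact: opb_unitr (unitaryC hS') (opb_unitl hS h).
  move=> /(opb_entry i j); rewrite E mul_diag_mx mul_mx_diag !mxE.
  by rewrite [X in _ - X]mulrC -mulrBl snormM mulrC.
have -> : \sum_j arg (d 0 j) = \sum_i \sum_j snorm (U i j) * arg (d 0 i).
  by apply: eq_bigr => i _; rewrite -mulr_suml unitary_row_sum ?mul1r.
have -> : \sum_j arg (d' 0 j) = \sum_i \sum_j snorm (U i j) * arg (d' 0 j).
  rewrite exchange_big /=; apply: eq_bigr => j _.
  by rewrite -mulr_suml unitary_col_sum ?mul1r.
rewrite -sumrB; apply: le_trans (ler_norm_sum _ _ _) _.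
apply: (@le_trans _ _ (\sum_(i < n) \sum_(j < n) (3 * eta))); last first.
  by rewrite !sumr_const card_ord -mulrnA -[X in X <= _]mulr_natl natrM -expr2.
apply: ler_sum => i _; rewrite -sumrB; apply: le_trans (ler_norm_sum _ _ _) _.
apply: ler_sum => j _; rewrite -mulrBr.
have u0 := snorm_ge0 (U i j).
have u1 : snorm (U i j) <= 1.
  rewrite -(unitary_row_sum i hU) (bigD1 j) //= lerDl.
  by rewrite sumr_ge0 // => k _; exact: snorm_ge0.
(* Squares are compared: with u = |U_ij|^2 <= 1, u^2 x^2 <= 7 u y <= 7 eta^2 <= 9 eta^2. *)
rewrite -[3 * eta]ger0_norm ?mulr_ge0 // -ler_sqr ?nnegrE //.
rewrite !real_normK ?num_real // exprMn.
have := arg_lip (ad i) (ad' j); have := E i j.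
move: (arg _ - arg _) (snorm (d 0 i - _)) => x y e1 e2.
have : snorm (U i j) ^+ 2 * x ^+ 2 <= snorm (U i j) * (7 * y).
  rewrite expr2 -mulrA ler_wpM2l // (le_trans _ e2) // ler_piMl ?sqr_ge0 //.
have := sqr_ge0 eta.
lra.
Qed.

Definition argsum W : R := \sum_j arg (spectral_diag W 0 j).

(** The case [eta = 0] of [sum_arg_close]: the sum does not depend on the eigenbasis chosen by
    [spectral_diag]. *)
Lemma argsum_diagonalizes S d W : diagonalizes S d W -> W \is unitarymx ->
  near1 1 W -> argsum W = \sum_j arg (d 0 j).
Proof.
move=> hd hW h; have hs := spectral_diagonalizes hW.
have h0 : opb (0 ^+ 2) (W - W) by rewrite subrr expr0n; exact: opb0.
have := sum_arg_close hs hd (near1_arc hs hW (lexx _) h)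
  (near1_arc hd hW (lexx _) h) (lexx 0) h0.
by rewrite !mulr0 normr_le0 subr_eq0 => /eqP.
Qed.

Lemma argsum_close eta W W' : W \is unitarymx -> W' \is unitarymx ->
  near1 1 W -> near1 1 W' -> 0 <= eta -> opb (eta ^+ 2) (W - W') ->
  `|argsum W - argsum W'| <= n%:R ^+ 2 * (3 * eta).
Proof.
move=> hW hW' h h'.
have hd := spectral_diagonalizes hW; have hd' := spectral_diagonalizes hW'.
exact: (sum_arg_close hd hd' (near1_arc hd hW (lexx _) h)
  (near1_arc hd' hW' (lexx _) h')).
Qed.

Lemma expi_argsum W : W \is unitarymx -> near1 1 W ->
  expi (argsum W) = \det W.
Proof.
move=> hW h; have hd := spectral_diagonalizes hW.
rewrite /argsum expi_sum; have [hS {2}->] := hd.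
rewrite !det_mulmx mulrAC -det_mulmx unitarymxC // det1 mul1r det_diag.
apply: eq_bigr => j _; rewrite expi_arg //.
exact: near1_arc hd hW (lexx _) h _.
Qed.

Lemma argsum_conj U W : U \is unitarymx -> W \is unitarymx -> near1 1 W ->
  argsum (U *m W *m U^t*) = argsum W.
Proof.
move=> hU hW h; have hd := spectral_diagonalizes hW.
apply: (argsum_diagonalizes (diagonalizes_conj hU hd)).
  exact: unitaryM (unitaryM hU hW) (unitaryC hU).
exact: near1_conj.
Qed.

Lemma diagonalizes_scalar (z : R[i]) : diagonalizes 1%:M (const_mx z) z%:M.
Proof.
split; first by apply/unitarymxP; rewrite mul1mx trmx1 map_mx1.
by rewrite trmx1 map_mx1 mul1mx mulmx1 diag_const_mx.
Qed.

Lemma unitary_scalar (t : R) : (expi t)%:M \is @unitarymx R[i] n n.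
Proof.
apply/(unitary_diagonalizes (diagonalizes_scalar _)) => j.
by rewrite mxE snorm_expi.
Qed.

Lemma near1_scalar (t : R) : near1 (t ^+ 2) ((expi t)%:M : 'M[R[i]]_n).
Proof.
apply/(near1_diagonalizes _ (diagonalizes_scalar _)) => j.
by rewrite mxE snorm_expiB1.
Qed.

Lemma argsum_scalar (t : R) : `|t| <= 1 ->
  argsum ((expi t)%:M : 'M[R[i]]_n) = n%:R * t.
Proof.
move=> t1; rewrite (argsum_diagonalizes (diagonalizes_scalar _)).
- under eq_bigr do rewrite mxE.
  rewrite sumr_const card_ord mulr_natl arg_expi //.
  move: t1 (@pi_ge2 R); rewrite ler_norml => /andP[] *.
  by apply/andP; split; lra.
- exact: unitary_scalar.
apply: (near1W (near1_scalar t)).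
by rewrite -[leRHS](expr1n _ 2) -ler_sqrt ?sqr_ge0 // !sqrtr_sqr normr1.
Qed.

Lemma unitary1 : 1%:M \is @unitarymx R[i] n n.
Proof. by apply/unitarymxP; rewrite trmx1 map_mx1 mul1mx. Qed.

Lemma near11 c : 0 <= c -> near1 c (1%:M : 'M[R[i]]_n).
Proof. by rewrite /near1 subrr => c0; apply: (opbW _ c0); exact: opb0. Qed.

Lemma argsum1 : argsum 1%:M = 0.
Proof.
have -> : 1%:M = (expi 0)%:M :> 'M[R[i]]_n by rewrite expi0.
by rewrite argsum_scalar ?normr0 ?mulr0.
Qed.

(* The determinant gives additivity modulo 2 pi, and all terms which could
   contribute to a jump are smaller than 2 pi when V is close enough to 1,
   in a sense which depends on the dimension. *)
Lemma argsumM_small : exists2 K : nat, (0 < K)%N &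
  forall V W, V \is unitarymx -> W \is unitarymx ->
    near1 (K%:R^-1 ^+ 2) V -> near1 (1 / 16) W ->
    argsum (V *m W) = argsum V + argsum W.
Proof.
(* With eta = 1/K the bound n^2 * 3 eta of [argsum_close] is at most 1, and 1/K <= 1/4 keeps
   [V *m W] within the range of [argsum]. *)
pose K : nat := (4 * (n ^ 2).+1)%N.
exists K => // V W hV hW nV nW.
have K0 : 0 <= (K%:R : R)^-1 by rewrite invr_ge0 ler0n.
have nK : (n%:R : R) ^+ 2 * (3 * K%:R^-1) <= 1.
  rewrite -natrX /K natrM -(natr1 (n ^ 2)%N) invfM.
  have m0 : 0 <= (n ^ 2)%N%:R :> R by rewrite ler0n.
  move: (n ^ 2)%N%:R m0 => m m0.
  have -> : m * (3 * (4^-1 / (m + 1))) = (3 / 4 * m) / (m + 1) by field; lra.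
  rewrite ler_pdivrMr; lra.
have K4 : (K%:R : R)^-1 ^+ 2 <= 1 / 16.
  have : (K%:R : R)^-1 <= 4^-1.
    by rewrite lef_pV2 ?posrE ?ltr0n ?ler_nat // /K leq_pmulr.
  move: _^-1 K0 => x; nra.
have hVW := unitaryM hV hW.
have nVW : near1 1 (V *m W).
  by apply: (near1W (near1M hV nV nW)); lra.
have {}nV1 : near1 1 V by apply: (near1W nV); lra.
have {}nW1 : near1 1 W by apply: (near1W nW); lra.
have d1 : `|argsum (V *m W) - argsum W| <= 1.
  have h : opb (K%:R^-1 ^+ 2) (V *m W - W).
    have -> : V *m W - W = (V - 1%:M) *m W by rewrite mulmxBl mul1mx.
    exact: opb_unitr.
  exact: le_trans (argsum_close hVW hW nVW nW1 K0 h) nK.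
have d2 : `|argsum V| <= 1.
  have := argsum_close hV unitary1 nV1 (near11 ler01) K0 nV.
  by rewrite argsum1 subr0 => /le_trans; exact.
have E : expi (argsum (V *m W) - (argsum V + argsum W)) = 1.
  have e0 : expi (argsum V + argsum W) * expi (- (argsum V + argsum W)) = 1.
    by rewrite -expiD subrr expi0.
  by rewrite expiD -[RHS]e0 expiD !expi_argsum ?det_mulmx.
(* The defect is a multiple of 2 pi by the determinant, and it is at most 2 < 2 pi in absolute value
   by [d1] and [d2]. *)
apply/eqP; rewrite -subr_eq0; apply/eqP; apply: expi_eq1 => //.
have := @pi_ge2 R; move: d1 d2; move: (argsum _) (argsum V) (argsum W) => x y z.
rewrite !ler_norml ltr_norml => /andP[? ?] /andP[? ?] ?.
by apply/andP; split; lra.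
Qed.

(** V is reached from 1 in K steps of size 1/K along a one-parameter group [P], each step small
    enough for [argsumM_small]. Every step adds [argsum (P K^-1)], whatever matrix stands to the
    right. *)
Lemma argsumM V W : V \is unitarymx -> W \is unitarymx ->
  near1 (1 / 1000) V -> near1 (1 / 1000) W ->
  argsum (V *m W) = argsum V + argsum W.
Proof.
move=> hV hW nV nW.
set S := spectralmx V; set d := spectral_diag V.
have hd : diagonalizes S d V by exact: spectral_diagonalizes.
have ad : forall j, arc (d 0 j) by apply: near1_arc hd hV _ nV; lra.
have hS : S \is unitarymx by case: hd.
pose D (t : R) := \row_j expi (t * arg (d 0 j)).
pose P t := S^t* *m diag_mx (D t) *m S.
have hP t : diagonalizes S (D t) (P t) by exact: conj hS erefl.
have uP t : P t \is unitarymx.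
  by apply/(unitary_diagonalizes (hP t)) => j; rewrite mxE snorm_expi.
have Pcong d1 d2 : d1 = d2 ->
    S^t* *m diag_mx d1 *m S = S^t* *m diag_mx d2 *m S by move->.
have PD s t : P (s + t) = P s *m P t.
  have -> : P s *m P t =
      S^t* *m diag_mx (D s) *m (S *m S^t*) *m diag_mx (D t) *m S.
    by rewrite /P !mulmxA.
  rewrite (unitarymxP hS) mulmx1 -[_ *m diag_mx (D t)]mulmxA mulmx_diag.
  by apply: Pcong; apply/rowP => j; rewrite !mxE mulrDl expiD.
have P1 : P 1 = V.
  rewrite [RHS](proj2 hd); apply: Pcong.
  by apply/rowP => j; rewrite mxE mul1r expi_arg.
have arg2 j : arg (d 0 j) ^+ 2 <= 7 / 1000.
  have a1 : arc (1 : R[i]).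
    by apply: arc_near1; rewrite ?subrr ?snorm0 ?snorm1.
  have arg1 : arg (1 : R[i]) = 0.
    rewrite -expi0 arg_expi //.
    by have := @pi_ge2 R; move=> ?; apply/andP; split; lra.
  have := arg_lip (ad j) a1; rewrite arg1 subr0.
  by have := (near1_diagonalizes _ hd).1 nV j; lra.
have nP t : near1 (t ^+ 2 * (7 / 1000)) (P t).
  apply/(near1_diagonalizes _ (hP t)) => j; rewrite mxE.
  by rewrite (le_trans (snorm_expiB1 _)) // exprMn ler_wpM2l ?sqr_ge0.
have [K K1 small] := argsumM_small.
have K0 : 0 < (K%:R : R) by rewrite ltr0n.
have step k (U : 'M[R[i]]_n) :
    U \is unitarymx -> near1 (1 / 1000) U -> (k <= K)%N ->
    argsum (P (k%:R / K%:R) *m U) = k%:R * argsum (P K%:R^-1) + argsum U.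
  move=> hU nU; elim: k => [|k IHk] kK.
    have P0 : P 0 = 1%:M.
      by rewrite -[P 0]mulmx1 -(unitarymxP (uP 0)) mulmxA -PD addr0.
    by rewrite mul0r P0 mul1mx mul0r add0r.
  have nPK : near1 (K%:R^-1 ^+ 2) (P K%:R^-1).
    have le1 (x : R) : x ^+ 2 * (7 / 1000) <= x ^+ 2.
      by have := sqr_ge0 x; lra.
    exact: near1W (nP K%:R^-1) (le1 _).
  (* All intermediate points stay close to 1 uniformly in the dimension: 2/1000 + 14/1000 <=
     1/16. *)
  have nPU : near1 (1 / 16) (P (k%:R / K%:R) *m U).
    apply: (near1W (near1M (uP (k%:R / K%:R)) (nP _) nU)).
    have : (k%:R / K%:R : R) ^+ 2 <= 1.
      rewrite -[leRHS](expr1n _ 2) ler_sqr ?nnegrE ?divr_ge0 ?ler0n //.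
      by rewrite ler_pdivrMr // mul1r ler_nat ltnW.
    lra.
  rewrite -natr1 mulrDl mul1r addrC PD -mulmxA.
  rewrite (small _ _ (uP K%:R^-1) (unitaryM (uP (k%:R / K%:R)) hU) nPK nPU).
  by rewrite (IHk (ltnW kK)); ring.
have PK : P (K%:R / K%:R) = V by rewrite divff ?gt_eqF.
(* The total increment is the same for [U = W] and for [U = 1], and the latter identifies it as
   [argsum V]. *)
have := step K W hW nW (leqnn _); rewrite PK => ->.
have n1 : near1 (1 / 1000) (1%:M : 'M[R[i]]_n) by apply: near11; lra.
have := step K 1%:M unitary1 n1 (leqnn _).
by rewrite PK mulmx1 argsum1 addr0 => ->.
Qed.

End ArgumentSum.

(** * Schatten norms *)

Section SchattenBounds.
Variables (R : realType) (k : nat).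
Implicit Types (M A : 'M[R[i]]_k).

Lemma normal_diagonalizes A : A \is normalmx ->
  diagonalizes (spectralmx A) (spectral_diag A) A.
Proof.
move=> /orthomx_spectralP e; split; first exact: spectral_unitarymx.
by rewrite -invmx_unitary ?spectral_unitarymx.
Qed.

Lemma gram_normal M : M^t* *m M \is normalmx.
Proof. by apply/normalmxP; rewrite adjM trmxCK. Qed.

(** The j-th eigenvalue of the Gram matrix is the squared norm of the j-th column of [M *m S^t*],
    hence nonnegative; in the coordinates [S *m v] the quadratic form is diagonal. *)
Lemma gram_spectral M : let S := spectralmx (M^t* *m M) in
  let d := fun j => complex.Re (spectral_diag (M^t* *m M) 0 j) in
  (forall j, 0 <= d j) /\
  (forall v, vnorm (M *m v) = \sum_j d j * snorm ((S *m v) j 0)).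
Proof.
move=> S d; have hd := normal_diagonalizes (gram_normal M).
have [hS eA] := hd; rewrite -/S in hd hS eA.
have dE j : spectral_diag (M^t* *m M) 0 j = (vnorm (col j (M *m S^t*)))%:C.
  have -> : spectral_diag (M^t* *m M) 0 j =
      diag_mx (spectral_diag (M^t* *m M)) j j.
    by rewrite mxE eqxx.
  rewrite -(diagonalizes_eq hd) vnormE -/S.
  have -> : S *m (M^t* *m M) *m S^t* = (M *m S^t*)^t* *m (M *m S^t*).
    by rewrite adjM trmxCK !mulmxA.
  by rewrite !mxE; apply: eq_bigr => i _; rewrite !mxE.
split=> [j|v]; first by rewrite /d dE /= vnorm_ge0.
apply: complexI; rewrite vnormE adjM mulmxA -[v^t* *m _ *m M]mulmxA eA.
have -> : v^t* *m (S^t* *m diag_mx (spectral_diag (M^t* *m M)) *m S) *m v =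
  (S *m v)^t* *m (diag_mx (spectral_diag (M^t* *m M)) *m (S *m v)).
  by rewrite adjM !mulmxA.
move: (S *m v) => w; rewrite [LHS]mxE raddf_sum /=; apply: eq_bigr => j _.
rewrite mul_diag_mx mxE [RHS]rmorphM /= snormE /d dE /=.
by rewrite !mxE mulrC -mulrA dE.
Qed.

Lemma gram_opb M c :
  (forall j, complex.Re (spectral_diag (M^t* *m M) 0 j) <= c) -> opb c M.
Proof.
move=> h v; have [d0 ->] := gram_spectral M.
rewrite -(vnorm_unitary v (spectral_unitarymx (M^t* *m M))) /vnorm mulr_sumr.
by apply: ler_sum => j _; rewrite ler_wpM2r // snorm_ge0.
Qed.

Lemma opb_exists M : exists c, opb c M.
Proof.
exists (\sum_j complex.Re (spectral_diag (M^t* *m M) 0 j)).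
apply: gram_opb => j.
have [d0 _] := gram_spectral M.
by rewrite (bigD1 j) //= lerDl sumr_ge0.
Qed.

Lemma mxtrace_psd_power A (s : R) :
  complex.Re (\tr (psd_power A s)) =
  \sum_j complex.Re (spectral_diag A 0 j) `^ s.
Proof.
rewrite /psd_power mxtrace_mulC mulmxA mulmxV; last first.
  exact/unitarymx_unit/spectral_unitarymx.
rewrite mul1mx /mxtrace.
have -> : \sum_i diag_mx (map_mx (fun z : R[i] => (complex.Re z `^ s)%:C)
    (spectral_diag A)) i i =
    (\sum_j complex.Re (spectral_diag A 0 j) `^ s)%:C.
  by rewrite raddf_sum /=; apply: eq_bigr => i _; rewrite !mxE eqxx.
by [].
Qed.

Lemma l2normE (v : 'cV[R[i]]_k) : l2norm v = Num.sqrt (vnorm v).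
Proof. by []. Qed.

Lemma vnorm0 : vnorm (0 : 'cV[R[i]]_k) = 0.
Proof. by rewrite /vnorm big1 // => i _; rewrite mxE snorm0. Qed.

Lemma l2norm_le1 (v : 'cV[R[i]]_k) : (l2norm v <= 1) = (vnorm v <= 1).
Proof. by rewrite l2normE -{1}sqrtr1 ler_sqrt. Qed.

Lemma l2norm_mul_le M (v : 'cV[R[i]]_k) :
  l2norm v <= 1 -> l2norm (M *m v) <= operator_norm M.
Proof.
move=> hv; have [c hc] := opb_exists M; apply: ub_le_sup; last by exists v.
exists (Num.sqrt `|c|) => _ [w hw <-]; rewrite l2normE ler_wsqrtr //.
apply: le_trans (hc w) _; apply: (@le_trans _ _ (`|c| * vnorm w)).
  by rewrite ler_wpM2r ?vnorm_ge0 ?ler_norm.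
by rewrite ler_piMr // -l2norm_le1.
Qed.

Lemma opb_operator_norm M : opb (operator_norm M ^+ 2) M.
Proof.
have [c hc] := opb_exists M; move=> v.
have [v0|v0] := eqVneq (vnorm v) 0.
  by have := hc v; rewrite v0 !mulr0.
have vp : 0 < vnorm v by rewrite lt_neqAle eq_sym v0 vnorm_ge0.
pose a := Num.sqrt (vnorm v).
have a2 : a ^+ 2 = vnorm v by rewrite sqr_sqrtr ?vnorm_ge0.
have ap : 0 < a by rewrite sqrtr_gt0.
pose w := (a^-1)%:C *: v.
have sa : snorm (a^-1)%:C = (vnorm v)^-1.
  by rewrite /snorm /= expr0n addr0 exprVn a2.
have w1 : vnorm w = 1 by rewrite vnormZ sa mulVf.
have : l2norm (M *m w) <= operator_norm M.
  by apply: l2norm_mul_le; rewrite l2norm_le1 w1.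
have w0 : 0 <= l2norm (M *m w) by rewrite l2normE sqrtr_ge0.
move=> h; have : l2norm (M *m w) ^+ 2 <= operator_norm M ^+ 2.
  by rewrite ler_sqr // nnegrE (le_trans w0).
rewrite l2normE sqr_sqrtr ?vnorm_ge0 // -scalemxAr vnormZ sa.
by rewrite mulrC ler_pdivrMr.
Qed.

(** The operator norm is dominated by every Schatten norm, since the power of each eigenvalue of the
    Gram matrix is one term of a nonnegative sum. *)
Lemma opb_schatten (p : \bar R) M : (0 < p)%E ->
  opb (schatten_norm p M ^+ 2) M.
Proof.
case: p => [r||] //=; last by move=> _; exact: opb_operator_norm.
rewrite lte_fin => r0; apply: gram_opb => j.
have [d0 _] := gram_spectral M.
rewrite mxtrace_psd_power; 
pose d j := complex.Re (spectral_diag (M^t* *m M) 0 j).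
rewrite -/(d j) -[\sum_i _]/(\sum_i d i `^ (r / 2)).
have T0 : 0 <= \sum_j d j `^ (r / 2).
  by rewrite sumr_ge0 // => *; exact: powR_ge0.
have h : d j `^ (r / 2) <= \sum_j d j `^ (r / 2).
  by rewrite (bigD1 j) //= lerDl sumr_ge0 // => *; exact: powR_ge0.
have -> : (\sum_j d j `^ (r / 2)) `^ r^-1 ^+ 2 =
    (\sum_j d j `^ (r / 2)) `^ (r / 2)^-1.
  by rewrite -powR_mulrn ?powR_ge0 // -powRrM invfM invrK.
have {1}-> : d j = (d j `^ (r / 2)) `^ (r / 2)^-1.
  have r2 : r / 2 != 0 by rewrite gt_eqF // divr_gt0.
  by rewrite -powRrM mulfV // powRr1 ?d0.
by rewrite ge0_ler_powR ?nnegrE ?powR_ge0 // invr_ge0 divr_ge0 // ltW.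
Qed.

Lemma schatten_ge0 (p : \bar R) M : (0 < p)%E -> 0 <= schatten_norm p M.
Proof.
case: p => [r||] //= _; first exact: powR_ge0.
apply: le_trans (l2norm_mul_le M (v := 0) _); rewrite ?l2norm_le1 ?vnorm0 //.
by rewrite l2normE sqrtr_ge0.
Qed.

(** The Gram matrix of z U is the scalar |z|^2, so its k eigenvalues all equal |z|^2. *)
Lemma schatten_unitaryZ (p : \bar R) (z : R[i]) (U : 'M[R[i]]_k) (t : R) :
  (0 < p)%E -> U \is unitarymx -> 0 <= t -> snorm z <= t ^+ 2 ->
  schatten_norm p (z *: U) <=
  match p with r%:E => k%:R `^ r^-1 * t | _ => t end.
Proof.
move=> p0 hU t0 zt; case: p p0 => [r||] //= r0; last first.
  apply: ge_sup.
    by exists (l2norm (z *: U *m 0)), 0 => //=; rewrite l2norm_le1 vnorm0.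
  move=> _ [w /= hw <-]; rewrite -scalemxAl l2normE vnormZ vnorm_unitary //.
  rewrite -[t]ger0_norm // -sqrtr_sqr ler_wsqrtr // -[leRHS]mulr1.
  rewrite ler_pM ?snorm_ge0 ?vnorm_ge0 //.
  by rewrite -l2norm_le1.
rewrite lte_fin in r0.
have e : (z *: U)^t* *m (z *: U) = ((snorm z)%:C)%:M.
  have -> : (z *: U)^t* = (z^*)%R *: U^t*.
    by apply/matrixP => i j; rewrite !mxE rmorphM.
  by rewrite -scalemxAl -scalemxAr unitarymxC // scalerA mulrC -snormE scalemx1.
have hd := normal_diagonalizes (gram_normal (z *: U)).
rewrite mxtrace_psd_power (eq_bigr (fun=> snorm z `^ (r / 2))); last first.
  move=> j _; congr (_ `^ _); have := diagonalizes_eq hd; rewrite [in LHS]e.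
  rewrite scalar_mxC -mulmxA (unitarymxP (spectral_unitarymx _)) mulmx1.
  by move=> /matrixP/(_ j j); rewrite !mxE eqxx !mulr1n => <-.
rewrite sumr_const card_ord -[_ *+ k]mulr_natl powRM ?powR_ge0 ?ler0n //.
rewrite ler_wpM2l ?powR_ge0 // -powRrM mulrAC mulfV ?gt_eqF // mul1r.
rewrite powR12_sqrt ?snorm_ge0 // -[t]ger0_norm // -sqrtr_sqr.
by rewrite ler_wsqrtr.
Qed.

End SchattenBounds.

(** For finite p = r the norm is at most n^(1/r) C / n = C n^(-s) with s = 1 - 1/r, and s is
    positive exactly because r > 1. For the operator norm the bound is C / n. *)
Lemma schatten_small (R : realType) (p : \bar R) (C eps : R) :
  (1 < p)%E -> 0 <= C -> 0 < eps ->
  exists n0 : nat, forall n, (n0 <= n)%N ->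
    forall (U : 'M[R[i]]_n) (z : R[i]), U \is unitarymx ->
      snorm z <= (C / n%:R) ^+ 2 -> schatten_norm p (z *: U) < eps.
Proof.
move=> p1 C0 e0; have p0 : (0 < p)%E by apply: lt_trans p1; rewrite lte01.
have q0 : 0 <= C / eps by rewrite divr_ge0 // ltW.
case: p p1 p0 => [r|p1 p0|] //.
  rewrite !lte_fin => r1 r0; pose s := 1 - r^-1.
  have s0 : 0 < s by rewrite subr_gt0 invf_lt1.
  exists (Num.bound ((C / eps) `^ s^-1)).+1 => n hn U z hU hz.
  have n0 : 0 < n%:R :> R by rewrite ltr0n (leq_trans _ hn).
  have hs : C / eps < n%:R `^ s.
    have -> : C / eps = ((C / eps) `^ s^-1) `^ s.
      by rewrite -powRrM mulVf ?gt_eqF // powRr1.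
    rewrite gt0_ltr_powR ?nnegrE ?powR_ge0 ?ler0n //.
    apply: lt_le_trans (archi_boundP _) _; first exact: powR_ge0.
    by rewrite ler_nat ltnW.
  apply: le_lt_trans (schatten_unitaryZ _ hU _ hz) _; rewrite ?lte_fin //.
    by rewrite divr_ge0 // ltW.
  have nE : (n%:R : R) = n%:R `^ r^-1 * n%:R `^ s.
    by rewrite -powRD ?subrKC ?powRr1 ?ler0n // (gt_eqF n0) implybT.
  have a0 : 0 < n%:R `^ r^-1 :> R by rewrite powR_gt0.
  have b0 : 0 < n%:R `^ s :> R by rewrite powR_gt0.
  rewrite [X in C / X]nE invfM mulrCA (mulrA _ _^-1) mulfV ?gt_eqF // mul1r.
  by rewrite ltr_pdivrMr // mulrC -ltr_pdivrMr.
exists (Num.bound (C / eps)).+1 => n hn U z hU hz.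
have n0 : 0 < n%:R :> R by rewrite ltr0n (leq_trans _ hn).
apply: le_lt_trans (schatten_unitaryZ _ hU _ hz) _ => //.
  by rewrite divr_ge0 // ltW.
rewrite ltr_pdivrMr // mulrC -ltr_pdivrMr //.
by apply: lt_le_trans (archi_boundP _) _; rewrite // ler_nat ltnW.
Qed.

(** * Projective representations by weighted shifts *)

Section ShiftRepresentations.
Variable R : realType.

Lemma expi_modz n (a b : int) : (0 < n)%N -> (a = b %[mod n%:Z])%Z ->
  expi (2 * pi / n%:R * a%:~R) = expi (2 * pi / n%:R * b%:~R) :> R[i].
Proof.
move=> n0 /eqP; rewrite eqz_mod_dvd => /dvdzP[c hc].
have -> : a = b + c * n%:Z by rewrite -hc addrC subrK.
rewrite -(expiDZ (2 * pi / n%:R * b%:~R) c) rmorphD rmorphM /= mulrDr.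
congr (expi (_ + _)); rewrite -[n%:Z%:~R]pmulrn.
by field; rewrite pnatr_eq0 -lt0n.
Qed.

Lemma ord_modz n (z : int) : (0 < n)%N ->
  exists i0 : 'I_n, forall i : 'I_n, (i%:Z == z %[mod n%:Z])%Z = (i == i0).
Proof.
move=> n0; have nZ : n%:Z != 0 by rewrite eqz_nat -lt0n.
have lt : (`|(z %% n%:Z)%Z|%N < n)%N.
  by rewrite -ltz_nat gez0_abs ?modz_ge0 // ltz_pmod.
exists (Ordinal lt) => i; rewrite -val_eqE /= -eqz_nat gez0_abs ?modz_ge0 //.
by rewrite modz_small // ltz_nat ltn_ord.
Qed.

Definition shift_mx n (c : int) (F : int -> int) : 'M[R[i]]_n :=
  \matrix_(i, j) if (i%:Z == j%:Z + c %[mod n%:Z])%Z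
    then expi (2 * pi / n%:R * (F j%:Z)%:~R) else 0.

Lemma shift_mx_unitary n c F : (0 < n)%N -> shift_mx n c F \is unitarymx.
Proof.
move=> n0; apply/unitarymxP/mulmx1C; apply/matrixP => j k; rewrite !mxE.
have [i0 h0] := ord_modz (j%:Z + c) n0; rewrite (bigD1 i0) //= big1; last first.
  by move=> i ii0; rewrite !mxE h0 (negbTE ii0) rmorph0 mul0r.
rewrite !mxE h0 eqxx addr0.
have -> : (i0%:Z == k%:Z + c %[mod n%:Z])%Z = (j == k).
  have := h0 i0; rewrite eqxx => /eqP ->.
  rewrite !eqz_mod_dvd opprD addrACA subrr addr0 -eqz_mod_dvd.
  by rewrite !modz_small ?ltz_nat ?ltn_ord.
case: eqP => [->|_]; last by rewrite mulr0.
by rewrite mulrC -snormE snorm_expi.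
Qed.

(** The row index reached by the second shift is only a representative of j + d modulo n;
    periodicity of [F] modulo n allows evaluation at j + d itself. *)
Lemma shift_mx_mul n c d e F H K (t : int) : (0 < n)%N -> e = c + d ->
  (forall j j', (j = j' %[mod n%:Z])%Z -> (F j = F j' %[mod n%:Z])%Z) ->
  (forall j, H j + F (j + d) = K j + t) ->
  shift_mx n c F *m shift_mx n d H =
  expi (2 * pi / n%:R * t%:~R) *: shift_mx n e K.
Proof.
move=> n0 -> hF hK; apply/matrixP => i j; rewrite !mxE.
have [l0 h0] := ord_modz (j%:Z + d) n0; rewrite (bigD1 l0) //= big1; last first.
  by move=> l ll0; rewrite !mxE h0 (negbTE ll0) mulr0.
have el : (l0%:Z = j%:Z + d %[mod n%:Z])%Z by apply/eqP; rewrite h0.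
rewrite !mxE h0 eqxx addr0.
have -> : (i%:Z == l0%:Z + c %[mod n%:Z])%Z =
    (i%:Z == j%:Z + (c + d) %[mod n%:Z])%Z.
  by rewrite -[in LHS]modzDml el modzDml (addrC c) addrA.
case: eqP => _; last by rewrite mul0r mulr0.
rewrite (expi_modz n0 (hF _ _ el)) -!expiD -!mulrDr -!rmorphD /=.
by rewrite addrC hK addrC.
Qed.

End ShiftRepresentations.

(** The rearrangement behind W(xy) = W(x) (rho(x) W(y) rho(x)^-1) exp(i t), with A = W(x), X =
    rho(x), B = W(y) and Y = rho(y). *)
Lemma mulmx_conj_scalar (K : comPzRingType) n (A X X' B Y Z : 'M[K]_n) (s : K) :
  X' *m X = 1%:M -> X *m Y = s *: Z ->
  A *m X *m (B *m Y) = A *m (X *m B *m X') *m s%:M *m Z.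
Proof.
move=> hX hY; rewrite -[RHS]mulmxA mul_scalar_mx -hY.
by rewrite -!mulmxA (mulmxA X') hX mul1mx.
Qed.

(** * Projective representations close to genuine ones *)

Section ProjectiveRepresentations.
Variables (R : realType) (G : groupType) (p : \bar R) (N : set nat).
Variables (rho : forall n, G -> 'M[R[i]]_n) (tau : G -> G -> int).
Hypothesis p1 : (1 < p)%E.
Hypothesis N0 : forall n, N n -> (0 < n)%N.
Hypothesis rhoU : forall n, N n -> forall x, rho n x \is unitarymx.
Hypothesis rhoM : forall n, N n -> forall x y,
  rho n x *m rho n y = expi (2 * pi / n%:R * (tau x y)%:~R) *: rho n (x * y)%g.

(** The defect is a scalar 1 - exp(i t) times a unitary, with t = O(1/n). *)
Lemma projective_asymptotic : asymptotic_rep p N (k := fun n => n) rho.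
Proof.
split=> // x y; apply/cvgrPdist_lt => e e0.
have C0 : 0 <= `|2 * pi * (tau x y)%:~R| :> R by [].
have [n0 hn0] := schatten_small p1 C0 e0.
exists n0 => // n /= hn Nn.
have p0 : (0 < p)%E by apply: lt_trans p1; rewrite lte01.
rewrite sub0r normrN ger0_norm ?schatten_ge0 //.
rewrite rhoM // -[X in X - _]scale1r -scalerBl; apply: hn0 => //.
  exact: rhoU.
rewrite -snormN opprB (le_trans (snorm_expiB1 _)) //.
rewrite -[X in X <= _]real_normK ?num_real //.
by rewrite mulrAC !normrM normfV (ger0_norm (ler0n _ n)).
Qed.

Lemma perturbable_near1 (c : R) :
  0 < c -> forall rho' : forall n, G -> 'M[R[i]]_n,
  (forall x, schatten_norm p (rho' n x - rho n x)
     @[n --> within N \oo] --> (0 : R)) ->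
  forall x, exists n0, forall n, (n0 <= n)%N -> N n ->
    near1 c (rho' n x *m (rho n x)^t*).
Proof.
move=> c0 rho' h x; have p0 : (0 < p)%E by apply: lt_trans p1; rewrite lte01.
have e0 : 0 < Num.sqrt c by rewrite sqrtr_gt0.
have /cvgrPdist_lt/(_ _ e0)[n0 _ hn0] := h x.
exists n0 => n hn Nn; have := hn0 n hn Nn.
rewrite sub0r normrN ger0_norm ?schatten_ge0 // => lt.
have o := opb_schatten (rho' n x - rho n x) p0.
have {}o : opb c (rho' n x - rho n x).
  apply: (opbW o); rewrite -(sqr_sqrtr (ltW c0)) ler_sqr ?nnegrE ?sqrtr_ge0 //.
    exact: ltW.
  exact: schatten_ge0.
rewrite /near1; have -> : rho' n x *m (rho n x)^t* - 1%:M =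
    (rho' n x - rho n x) *m (rho n x)^t*.
  by rewrite mulmxBl (unitarymxP (rhoU Nn x)).
exact: opb_unitr (unitaryC (rhoU Nn x)) o.
Qed.

(** The scalar factor contributes n t, in which the dimension cancels. The constant 1/4000 is chosen
    so that [W x *m Q] is still within the 1/1000 required by [argsumM]. *)
Lemma argsum_defect n (rho' : G -> 'M[R[i]]_n) (x y : G) :
  let W z := rho' z *m (rho n z)^t* in
  N n -> unitary_rep rho' ->
  near1 (1 / 4000) (W x) -> near1 (1 / 4000) (W y) ->
  (2 * pi / n%:R * (tau x y)%:~R) ^+ 2 <= (1 / 1000 : R) ->
  argsum (W (x * y)%g) = argsum (W x) + argsum (W y) + 2 * pi * (tau x y)%:~R.
Proof.
move=> W Nn [uR' rM] nx ny ht.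
have uW z : W z \is unitarymx by exact: unitaryM (uR' z) (unitaryC (rhoU Nn z)).
set t := 2 * pi / n%:R * (tau x y)%:~R in ht.
set Q := rho n x *m W y *m (rho n x)^t*.
have uQ : Q \is unitarymx.
  exact: unitaryM (unitaryM (rhoU Nn x) (uW y)) (unitaryC (rhoU Nn x)).
have nQ : near1 (1 / 4000) Q by exact: near1_conj (rhoU Nn x) ny.
have e : W (x * y)%g = W x *m Q *m (expi t)%:M.
  have h z : W z *m rho n z = rho' z.
    by rewrite /W -mulmxA (unitarymxC (rhoU Nn z)) mulmx1.
  have h2 : W (x * y)%g *m rho n (x * y)%g =
      W x *m Q *m (expi t)%:M *m rho n (x * y)%g.
    rewrite h rM -(h x) -(h y).
    exact: mulmx_conj_scalar (unitarymxC (rhoU Nn x)) (rhoM Nn x y).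
  have := congr1 (fun Z => Z *m (rho n (x * y)%g)^t*) h2.
  by rewrite /= !(mulmxtVK _ (rhoU Nn (x * y)%g)).
have le (c c' : R) (V : 'M[R[i]]_n) : near1 c V -> c <= c' -> near1 c' V.
  exact: near1W.
have l1 : 1 / 4000 <= 1 / 1000 :> R by lra.
have l2 : 2 * (1 / 4000) + 2 * (1 / 4000) <= 1 / 1000 :> R by lra.
have l3 : 1 / 4000 <= 1 :> R by lra.
have t1 : `|t| <= 1.
  rewrite -ler_sqr ?nnegrE // real_normK ?num_real // expr1n.
  by apply: le_trans ht _; lra.
have ne : near1 (1 / 1000) ((expi t)%:M : 'M[R[i]]_n).
  exact: le _ _ _ (@near1_scalar R n t) ht.
rewrite e (argsumM (unitaryM (uW x) uQ) (@unitary_scalar R n t)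
  (le _ _ _ (near1M (uW x) nx nQ) l2) ne).
rewrite (argsumM (uW x) uQ (le _ _ _ nx l1) (le _ _ _ nQ l1)).
rewrite (argsum_conj (rhoU Nn x) (uW y) (le _ _ _ ny l3)).
rewrite argsum_scalar // /t; congr (_ + _).
have n0 : n%:R != 0 :> R by rewrite pnatr_eq0 -lt0n N0.
by field.
Qed.

(** Each pair is settled by all large n in [N], so one n serves a whole finite list; the cochain is
    [argsum (W n z) / (2 pi)] at that n. *)
Lemma perturbable_real_coboundary (L : seq (G * G)) :
  (forall k, exists2 n, (k <= n)%N & N n) ->
  perturbable p N (k := fun n => n) rho ->
  exists f : G -> R, forall x y, (x, y) \in L ->
    f (x * y)%g = f x + f y + (tau x y)%:~R.
Proof.
move=> Ninf [rho' hrep hcvg].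
have c0 : 0 < 1 / 4000 :> R by lra.
pose W n z := rho' n z *m (rho n z)^t*.
pose f n z := argsum (W n z) / (2 * pi).
have ev xy : exists n0, forall n, (n0 <= n)%N -> N n ->
    f n (xy.1 * xy.2)%g = f n xy.1 + f n xy.2 + (tau xy.1 xy.2)%:~R.
  case: xy => x y /=.
  have [n1 h1] := perturbable_near1 c0 hcvg x.
  have [n2 h2] := perturbable_near1 c0 hcvg y.
  set C := `|2 * pi * (tau x y)%:~R| : R.
  (* The last summand gives C / n <= 1/100, whose square is below 1/1000. *)
  exists (n1 + n2 + (Num.bound (100 * C)).+1)%N => n hn Nn.
  have n0 : 0 < n%:R :> R by rewrite ltr0n N0.
  rewrite /f (@argsum_defect n (rho' n) x y Nn (hrep n Nn)).
  - have pi0 : (pi : R) != 0 by rewrite gt_eqF ?pi_gt0.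
    move: (argsum _) (argsum _) (pi : R) pi0 => u v q q0.
    by field.
  - by apply: h1 => //; rewrite (leq_trans _ hn) // -addnA leq_addr.
  - by apply: h2 => //; rewrite (leq_trans _ hn) // addnAC leq_addl.
  have : C / n%:R <= 1 / 100.
    rewrite ler_pdivrMr //; have : 100 * C <= n%:R; last by lra.
    apply/ltW/(lt_le_trans (archi_boundP _)).
      exact: mulr_ge0 (ler0n _ 100) (normr_ge0 _).
    by rewrite ler_nat (leq_trans _ hn) // (leq_trans (leqnSn _)) // leq_addl.
  have : 0 <= C / n%:R by exact: divr_ge0 (normr_ge0 _) (ltW n0).
  have -> : (2 * pi / n%:R * (tau x y)%:~R) ^+ 2 = (C / n%:R) ^+ 2 :> R.
    rewrite -[LHS]real_normK ?num_real //; congr (_ ^+ 2).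
    by rewrite mulrAC normrM normfV (gtr0_norm n0).
  by move: (C / _) => u u0 u1; nra.
have [n0 hn0] : exists n0, forall n, (n0 <= n)%N -> N n ->
    forall xy, xy \in L ->
    f n (xy.1 * xy.2)%g = f n xy.1 + f n xy.2 + (tau xy.1 xy.2)%:~R.
  elim: L => [|xy L [n1 h1]]; first by exists 0%N.
  have [n2 h2] := ev xy; exists (n1 + n2)%N => n hn Nn xy'.
  rewrite inE => /predU1P[->|].
    by apply: h2 => //; exact: leq_trans (leq_addl _ _) hn.
  by apply: h1 => //; exact: leq_trans (leq_addr _ _) hn.
have [n hn Nn] := Ninf n0; exists (f n) => x y hL.
exact: (hn0 n hn Nn (x, y) hL).
Qed.

End ProjectiveRepresentations.

(** * Real coboundaries on finite sets *)

Section RationalSolutions.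
Variables (K : numFieldType) (U : eqType) (d : nat) (E : U -> 'rV[rat]_d.+1).

Let V (L : seq U) := (\sum_(u <- L) <<E u>>)%MS.

Let V_sub L u : u \in L -> (E u <= V L)%MS.
Proof.
move=> uL; rewrite /V (big_rem u) //= -(genmxE (E u)); exact: addsmxSl.
Qed.

(** Ranks are at most d + 1, so some finite list has maximal rank, and its span then absorbs every
    row. *)
Let V_full : exists L, forall u, (E u <= V L)%MS.
Proof.
pose P r := `[< exists L, \rank (V L) = r >].
have exP : exists r, P r by exists (\rank (V [::])); apply/asboolP; exists [::].
have bP r : P r -> (r <= d.+1)%N.
  by move=> /asboolP[L <-]; exact: rank_leq_col.
case: (ex_maxnP exP bP) => r /asboolP[L hL] hmax; exists L => u.
have sVL : (V L <= V (u :: L))%MS by rewrite /V big_cons addsmxSr.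
apply: submx_trans (V_sub (mem_head u L)) _.
rewrite -(mxrank_leqif_sup sVL) eqn_leq mxrankS //= hL.
by apply: hmax; apply/asboolP; exists (u :: L).
Qed.

(* Column 0 of E holds the constant terms. *)
Lemma rational_solution :
  (forall L : seq U, exists h : 'I_d -> K, forall u, u \in L ->
     ratr (E u 0 0) + \sum_i ratr (E u 0 (lift ord0 i)) * h i = 0) ->
  exists h : 'I_d -> rat, forall u,
     E u 0 0 + \sum_i E u 0 (lift ord0 i) * h i = 0.
Proof.
move=> sol; have [L hL] := V_full; have [h hh] := sol L.
pose w : 'cV[K]_d.+1 := \col_i (if unlift ord0 i is Some j then h j else 1).
have Ew (u : 'rV[K]_d.+1) :
    (u *m w) 0 0 = u 0 0 + \sum_i u 0 (lift ord0 i) * h i.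
  rewrite mxE big_ord_recl !mxE unlift_none mulr1; congr (_ + _).
  by apply: eq_bigr => i _; rewrite mxE liftK.
have Vw : map_mx (@ratr K) (V L) *m w = 0.
  apply/sub_kermxP; rewrite /V; move: hh; elim: L {hL} => [|u L IHL] hh.
    by rewrite big_nil map_mx0 sub0mx.
  rewrite big_cons map_addsmx addsmx_sub map_genmx genmxE.
  rewrite IHL ?andbT => [|v vL]; last by rewrite hh ?inE ?vL ?orbT.
  apply/sub_kermxP/matrixP => i j; rewrite !ord1 Ew !mxE.
  by under eq_bigr do rewrite mxE; rewrite hh ?inE ?eqxx.
(* Over K every row of [V L] is orthogonal to w = (1, h), but the first unit vector is not;
   membership in a row space is insensitive to field extension. *)
have e0 : ~~ ((delta_mx 0 0 : 'rV[rat]_d.+1) <= V L)%MS.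
  rewrite -(map_submx (@ratr K)); apply/negP => /submxP[D hD].
  have := congr1 (fun X => (X *m w) 0 0) hD.
  rewrite -mulmxA Vw mulmx0 Ew !mxE eqxx rmorph1 big1 => [|i _].
    by move/eqP; rewrite addr0 oner_eq0.
  by rewrite !mxE /= rmorph0 mul0r.
(* So some rational column orthogonal to all rows has a nonzero entry at index 0; dividing by that
   entry gives the solution. *)
rewrite submxE in e0; have [j hj] : exists j, cokermx (V L) 0 j != 0.
  apply/existsP; rewrite -[X in is_true X]negbK negb_exists; apply: contra e0.
  move=> /forallP h0; apply/eqP/rowP => j; rewrite -rowE mxE [RHS]mxE.
  by have := h0 j; rewrite negbK => /eqP.
exists (fun i => cokermx (V L) (lift ord0 i) j / cokermx (V L) 0 j) => u.
have : (E u *m cokermx (V L)) 0 j = 0.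
  by move: (hL u); rewrite submxE => /eqP ->; rewrite mxE.
rewrite mxE big_ord_recl; set c := cokermx (V L) 0 j in hj *.
move=> /(congr1 (fun z => z / c)); rewrite mul0r mulrDl mulfK // => e.
rewrite -[RHS]e; congr (_ + _); rewrite mulr_suml.
by apply: eq_bigr => i _; rewrite mulrA.
Qed.

End RationalSolutions.

(** * From real cochains on finite sets to torsion *)

Section TorsionFromRealCoboundaries.
Variables (K : numFieldType) (G : groupType) (tau : G -> G -> int).

Let solves (f : G -> K) (L : seq (G * G)) := forall x y, (x, y) \in L ->
  f (x * y)%g = f x + f y + (tau x y)%:~R.

Let solves_cat f L L' : solves f (L ++ L') -> solves f L /\ solves f L'.
Proof. by move=> h; split=> x y xL; apply: h; rewrite mem_cat xL ?orbT. Qed.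

Variables (d : nat) (g : 'I_d -> G).

(** Finitely many equations force [f x] to be an integral affine function, the same for all [f], of
    the values on the generators. The unknown cochain is thus reduced to [d] unknowns. *)
Let affine x := exists (c : 'I_d -> int) (b : int) (L : seq (G * G)),
  forall f, solves f L -> f x = \sum_i (c i)%:~R * f (g i) + b%:~R.

Let affine_subgroup : is_subgroup (affine : set G).
Proof.
have f1 f : solves f [:: (1, 1)%g] -> f 1%g = - (tau 1 1)%g%:~R.
  move=> h; have := h 1%g 1%g; rewrite inE eqxx mulg1 => /(_ isT) e.
  move: e; move: (f 1%g) (_%:~R) => u v e; apply/eqP.
  by rewrite -addr_eq0 -(subrr u) [X in _ == X - _]e; apply/eqP; ring.
split.
- exists (fun=> 0), (- tau 1 1)%g, [:: (1, 1)%g] => f /f1 ->.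
  by rewrite big1 ?add0r ?rmorphN // => i _; rewrite mul0r.
- move=> x y [c [b [L h]]] [c' [b' [L' h']]].
  exists (fun i => c i + c' i), (b + b' + tau x y), ((L ++ L') ++ [:: (x, y)]).
  move=> f /solves_cat[/solves_cat[/h e /h' e'] hxy].
  rewrite hxy ?inE ?eqxx // e e' !rmorphD /=.
  under [in RHS]eq_bigr do rewrite rmorphD mulrDl.
  by rewrite big_split /=; ring.
move=> x [c [b [L h]]].
exists (fun i => - c i), (- b - tau x x^-1%g - tau 1%g 1%g),
  (L ++ [:: (x, x^-1)%g; (1, 1)%g]).
move=> f /solves_cat[/h e hx].
have := hx x x^-1%g; rewrite inE eqxx mulgV f1; last first.
  by move=> y z; rewrite inE => yz; apply: hx; rewrite !inE yz orbT.
move=> /(_ isT) e'.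
have -> : \sum_i (- c i)%:~R * f (g i) = - \sum_i (c i)%:~R * f (g i).
  by rewrite -sumrN; apply: eq_bigr => i _; rewrite rmorphN mulNr.
rewrite !rmorphB rmorphN /=.
rewrite e in e'; move: e'; move: (\sum_i _) => S e'.
have -> : f x^-1%g = (S + b%:~R + f x^-1%g + (tau x x^-1%g)%:~R)
  - S - b%:~R - (tau x x^-1%g)%:~R by ring.
by rewrite -e'; ring.
Qed.

(** Substituting the affine expressions turns the coboundary equations into a linear system in [d]
    unknowns, solvable over K on finite sublists and hence over the rationals. A common denominator
    of the solution then kills the class. *)
Lemma torsion_of_real_coboundary : generated (range g) = [set: G] ->
  (forall L : seq (G * G), exists f : G -> K, solves f L) -> torsion_class tau.
Proof.
move=> gen sol.
have aff x : affine x.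
  have : generated (range g) x by rewrite gen.
  move=> /(_ affine); apply; split; first exact: affine_subgroup.
  move=> _ [i _ <-]; exists (fun j => (j == i)%:Z), 0, [::] => f _.
  rewrite (bigD1 i) //= eqxx mul1r big1 ?addr0 // => j /negPf ->.
  by rewrite mul0r.
pose c x := projT1 (cid (aff x)).
pose b x := projT1 (cid (projT2 (cid (aff x)))).
have hcb x : exists L, forall f, solves f L ->
    f x = \sum_i (c x i)%:~R * f (g i) + (b x)%:~R.
  exact: projT2 (cid (projT2 (cid (aff x)))).
pose E (u : G * G) : 'rV[rat]_d.+1 := \row_k
  if unlift ord0 k is Some i
  then (c (u.1 * u.2)%g i - c u.1 i - c u.2 i)%:~R
  else (b (u.1 * u.2)%g - b u.1 - b u.2 - tau u.1 u.2)%:~R.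
have E0 u : E u 0 0 = (b (u.1 * u.2)%g - b u.1 - b u.2 - tau u.1 u.2)%:~R.
  by rewrite mxE unlift_none.
have ES u i : E u 0 (lift ord0 i) = (c (u.1 * u.2)%g i - c u.1 i - c u.2 i)%:~R.
  by rewrite mxE liftK.
have [L|h hh] := @rational_solution K _ d E.
  have [L' hL'] : exists L', forall f : G -> K, solves f L' ->
      forall u, u \in L ->
      f (u.1 * u.2)%g = f u.1 + f u.2 + (tau u.1 u.2)%:~R /\
      forall x, x \in [:: u.1; u.2; u.1 * u.2]%g ->
        f x = \sum_i (c x i)%:~R * f (g i) + (b x)%:~R.
    elim: L => [|[x y] L [L' hL']]; first by exists [::].
    have [L1 h1] := hcb x; have [L2 h2] := hcb y; have [L3 h3] := hcb (x * y)%g.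
    exists ((((x, y) :: L') ++ L1) ++ (L2 ++ L3)) => f.
    move=> /solves_cat[/solves_cat[hf /h1 e1] /solves_cat[/h2 e2 /h3 e3]] u.
    rewrite inE => /predU1P[->|uL]; last first.
      by apply: hL' uL => x' y' h'; apply: hf; rewrite inE h' orbT.
    split; first by apply: hf; rewrite mem_head.
    by move=> z; rewrite !inE => /or3P[] /eqP ->.
  have [f /hL' hf] := sol L'; exists (f \o g) => u uL.
  have [e] := hf u uL.
  have -> : ratr (E u 0 0) = (b (u.1 * u.2)%g)%:~R - (b u.1)%:~R - (b u.2)%:~R
      - (tau u.1 u.2)%:~R :> K by rewrite E0 ratr_int !rmorphB.
  have -> : \sum_i ratr (E u 0 (lift ord0 i)) * (f \o g) i =
      \sum_i (c (u.1 * u.2)%g i)%:~R * f (g i) - \sum_i (c u.1 i)%:~R * f (g i)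
      - \sum_i (c u.2 i)%:~R * f (g i) :> K.
    rewrite -!sumrB; apply: eq_bigr => i _.
    by rewrite ES ratr_int !rmorphB /= !mulrBl.
  move=> hx; have := hx u.1; have := hx u.2; have := hx (u.1 * u.2)%g.
  rewrite !inE !eqxx !orbT => /(_ isT) e3 /(_ isT) e2 /(_ isT) e1.
  move: e; rewrite e1 e2 e3; move: (\sum_i _) (\sum_i _) (\sum_i _) => S1 S2 S3.
  move=> /eqP; rewrite -subr_eq0 => /eqP e; apply/eqP.
  by rewrite -[X in _ == X]e; apply/eqP; ring.
pose M := (\prod_i `|denq (h i)|)%N.
have M0 : (0 < M)%N by rewrite prodn_gt0 // => i; rewrite absz_gt0 denq_neq0.
have hM i : exists z : int, M%:R * h i = z%:~R.
  exists ((\prod_(j | j != i) `|denq (h j)|)%N%:Z * numq (h i)).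
  rewrite /M (bigD1 i) //= natrM rmorphM /= -pmulrn -{2}(divq_num_den (h i)).
  rewrite natr_absz gtr0_norm ?denq_gt0 // mulrAC mulrCA mulrA.
  by rewrite [_ / (denq _)%:~R]mulfK ?intr_eq0 ?denq_neq0 // mulrC.
pose z i := projT1 (cid (hM i)).
have hz i : M%:R * h i = (z i)%:~R by exact: projT2 (cid (hM i)).
(* The sign changes because the equations read f(xy) = f(x) + f(y) + tau(x, y), whereas coboundaries
   are f(y) - f(xy) + f(x). *)
exists M => //; exists (fun x => - (\sum_i c x i * z i + b x *+ M)).
move=> x y _ _.
have : M%:Z * (b (x * y)%g - b x - b y - tau x y) +
    (\sum_i c (x * y)%g i * z i - \sum_i c x i * z i - \sum_i c y i * z i) = 0.
  apply: (@intr_inj rat); rewrite rmorphD rmorphM /= -(E0 (x, y)) -pmulrn.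
  rewrite -[RHS](mulr0 M%:R) -[in RHS](hh (x, y)) mulrDr; congr (_ + _).
  rewrite mulr_sumr -!sumrB rmorph_sum /=; apply: eq_bigr => i _.
  by rewrite ES /= mulrCA hz -rmorphM /= !mulrBl.
have nM (u : int) : u *+ M = M%:Z * u by rewrite -mulr_natl natz.
rewrite !nM.
generalize (\sum_i c (x * y)%g i * z i) (\sum_i c x i * z i)
  (\sum_i c y i * z i).
move=> S1 S2 S3 e.
by apply/eqP; rewrite -subr_eq0 -oppr_eq0 -[X in _ == X]e; apply/eqP; ring.
Qed.

End TorsionFromRealCoboundaries.

(** * The canonical homomorphism of a Mal'cev basis *)

Section GroupGeneralities.
Local Open Scope group_scope.
Variable G : groupType.
Implicit Types (A B : set G) (x y : G).

Lemma zexpg0 x : zexpg x 0 = 1.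
Proof. by []. Qed.

Lemma zexpgS x z : zexpg x (z + 1) = zexpg x z * x.
Proof.
case: z => [n|[|n]]; first by rewrite addrC -intS /= expgSr.
  by rewrite /= expg1 mulVg.
have -> : (Negz n.+1 + 1)%R = Negz n by rewrite !NegzE !intS; ring.
by rewrite /= [X in X^-1 * x]expgS invgM mulgVK.
Qed.

Lemma zexpgD x a b : zexpg x (a + b) = zexpg x a * zexpg x b.
Proof.
have pred z : zexpg x (z - 1) = zexpg x z * x^-1.
  by rewrite -[in RHS](subrK 1%R z) zexpgS mulgK.
elim/int_rect: b => [|n IH|n IH]; first by rewrite addr0 mulg1.
  by rewrite intS (addrC 1%R) addrA !zexpgS IH mulgA.
by rewrite intS opprD (addrC (-1)%R) addrA !pred IH mulgA.
Qed.

Lemma zexpg1 x : zexpg x 1 = x.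
Proof. by rewrite /= expg1. Qed.

Lemma zexpgN x a : zexpg x (- a) = (zexpg x a)^-1.
Proof.
by apply: (mulgI (zexpg x a)); rewrite -zexpgD subrr mulgV.
Qed.

Lemma generated_subgroup A : is_subgroup (generated A).
Proof.
split=> [B [hB _]|x y hx hy B [hB AB]|x hx B [hB AB]].
- by case: hB.
- by case: (hB) => _ h _; apply: h; [exact: hx|exact: hy].
by case: (hB) => _ _ h; apply: h; exact: hx.
Qed.

Lemma sub_generated A : A `<=` generated A.
Proof. exact: sub_smallest. Qed.

Lemma generated_min A B : is_subgroup B -> A `<=` B -> generated A `<=` B.
Proof. by move=> hB AB; apply: smallest_sub. Qed.

Lemma subgroup_zexpg A x z : is_subgroup A -> A x -> A (zexpg x z).
Proof.
move=> [h1 h2 h3] Ax; elim/int_rect: z => [|n IH|n IH]; first exact: h1.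
  by rewrite intS addrC zexpgS; apply: h2.
rewrite intS opprD addrC -[X in A X](mulgK x) -zexpgS subrK.
by apply: h2 => //; apply: h3.
Qed.

End GroupGeneralities.

Section CanonicalHom.
Local Open Scope group_scope.
Variables (G : groupType) (m : nat) (a : 'I_m.+1 -> G).
Hypothesis ha : malcev_basis a.

Let Gam := malcev_sub a.

Lemma malcev_sub_subgroup i : is_subgroup (Gam i).
Proof. exact: generated_subgroup. Qed.

Lemma malcev_subS i : Gam i.+1 `<=` Gam i.
Proof.
apply: generated_min; first exact: malcev_sub_subgroup.
by move=> _ [j ij ->]; apply: sub_generated; exists j => //; exact: ltnW.
Qed.

Lemma malcev_sub_end i : (m < i)%N -> Gam i `<=` [set 1].
Proof.
move=> mi; apply: generated_min.
  by split=> [|x y -> ->|x ->]; rewrite /= ?mulg1 ?invg1.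
move=> g [j ij _]; have := leq_trans mi (leq_trans ij (leq_ord j)).
by rewrite ltnn.
Qed.

Lemma malcev_sub_comm i x y : Gam i y -> Gam i.+1 [~ x, y].
Proof.
have [im|mi] := ltnP i m.+1; move=> hy.
  by apply: (ha.2 i im); apply: sub_generated; exists x, y.
have -> : y = 1 by exact: malcev_sub_end hy.
by rewrite commg1; case: (malcev_sub_subgroup i.+1).
Qed.

Lemma malcev_sub_conj i x y : Gam i y -> Gam i (y ^ x).
Proof.
move=> hy; have [_ h2 h3] := malcev_sub_subgroup i.
rewrite -(mulVKg y (y ^ x)) -commgEl; apply: h2 => //.
rewrite -invgR; apply: h3.
by apply: malcev_subS; exact: malcev_sub_comm.
Qed.

Definition set_coord (x : {ffun 'I_m.+1 -> int}) i z : {ffun 'I_m.+1 -> int} :=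
  [ffun j => if j == i then z else x j].

Lemma malcev_word_set (x : {ffun 'I_m.+1 -> int}) (i : 'I_m.+1) z :
  (forall j : 'I_m.+1, (j <= i)%N -> x j = 0%R) ->
  malcev_word a (set_coord x i z) = zexpg (a i) z * malcev_word a x.
Proof.
move=> hx.
have E (y : {ffun 'I_m.+1 -> int}) : malcev_word a y =
    \prod_(0 <= j < m.+1) zexpg (a (inord j)) (y (inord j)).
  by rewrite big_mkord; apply: eq_bigr => j _; rewrite inord_val.
rewrite !E (@big_cat_nat _ _ _ i.+1) //= (@big_cat_nat _ _ _ i.+1 0 m.+1) //=.
rewrite !(@big_nat_recr _ _ _ i 0%N) //= inord_val ffunE eqxx [x i]hx //.
rewrite zexpg0 mulg1.
have low (y : {ffun 'I_m.+1 -> int}) :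
    (forall j : 'I_m.+1, (j < i)%N -> y j = 0%R) ->
    \prod_(0 <= j < i) zexpg (a (inord j)) (y (inord j)) = 1.
  move=> hy; rewrite big_nat big1 // => j /andP[_ ji].
  by rewrite hy // inordK // (ltn_trans ji).
rewrite !low ?mul1g => [|j ji|j ji]; last 2 first.
- by rewrite hx // ltnW.
- by rewrite ffunE -val_eqE ltn_eqF // hx // ltnW.
congr (_ * _); apply: eq_big_nat => j /andP[ij jm]; rewrite ffunE.
by rewrite -val_eqE /= inordK // gtn_eqF.
Qed.

(** The products of a power of [a i] with an element of the next subgroup form a subgroup, because
    the next subgroup is stable under conjugation. *)
Lemma malcev_sub_cyclic (i : 'I_m.+1) g :
  Gam i g -> exists z, exists2 h, Gam i.+1 h & g = zexpg (a i) z * h.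
Proof.
move: g; apply: generated_min; last first.
  move=> _ [j ij ->]; move: ij; rewrite leq_eqVlt => /orP[/eqP/val_inj <-|ij].
    exists 1%R, 1; rewrite ?zexpg1 ?mulg1 //.
    by case: (malcev_sub_subgroup i.+1).
  by exists 0%R, (a j); rewrite ?mul1g //; apply: sub_generated; exists j.
have [h1 h2 h3] := malcev_sub_subgroup i.+1; split.
- by exists 0%R, 1; rewrite ?mulg1.
- move=> _ _ [z [h hh ->]] [z' [h' hh' ->]].
  exists (z + z')%R, (h ^ (zexpg (a i) z') * h').
    by apply: h2 => //; exact: malcev_sub_conj.
  by rewrite zexpgD /conjg !mulgA mulgK.
move=> _ [z [h hh ->]]; exists (- z)%R, (h^-1 ^ (zexpg (a i) (- z))).
  by apply: malcev_sub_conj; exact: h3.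
by rewrite /conjg !mulgA mulgV mul1g invgM zexpgN.
Qed.

Lemma malcev_sub_word i g : (i <= m.+1)%N -> Gam i g ->
  exists2 x : {ffun 'I_m.+1 -> int},
    (forall j : 'I_m.+1, (j < i)%N -> x j = 0%R) & g = malcev_word a x.
Proof.
(* Downward induction on i, run as induction on k = m + 1 - i: each step puts one power of a basis
   element in front. *)
move=> im; rewrite -(subKn im).
move: (m.+1 - i)%N (leq_subr i m.+1) => k {i im}.
elim: k g => [|k IHk] g km.
  rewrite subn0 => /(malcev_sub_end (leqnn _)) ->; exists [ffun=> 0%R].
    by move=> j; rewrite ffunE.
  by rewrite /malcev_word big1 // => i _; rewrite ffunE.
have lt : (m.+1 - k.+1 < m.+1)%N by rewrite ltn_subrL.
have e : (m.+1 - k.+1).+1 = (m.+1 - k)%N by rewrite -subSn // subSS.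
move=> /(@malcev_sub_cyclic (Ordinal lt))[z [h]] /=; rewrite e.
move=> /(IHk _ (ltnW km))[x hx ->] ->; exists (set_coord x (Ordinal lt) z).
  move=> j ji; rewrite ffunE -val_eqE /= ltn_eqF // hx // -e ltnW //.
by rewrite malcev_word_set // => j /= ji; rewrite hx // -e ltnS.
Qed.

(** With uniqueness of coordinates, this makes [canonical_hom] the projection modulo the normal
    subgroup [Gam 1]; additivity follows. *)
Lemma canonical_hom_unique z h : Gam 1 h ->
  canonical_hom a (zexpg (a ord0) z * h) = z.
Proof.
move=> /(malcev_sub_word (isT : 1 <= m.+1)%N)[x hx ->].
rewrite -malcev_word_set => [|j j0]; last by rewrite hx // ltnS.
by rewrite /canonical_hom malcev_coordK // ffunE eqxx.
Qed.

Lemma canonical_hom_decomp g :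
  exists2 h, Gam 1 h & g = zexpg (a ord0) (canonical_hom a g) * h.
Proof.
have [|z [h hh e]] := @malcev_sub_cyclic ord0 g; last first.
  by exists h => //; rewrite {2}e canonical_hom_unique.
have [x [-> _]] := ha.1 g; have [h1 h2 _] := malcev_sub_subgroup 0.
rewrite /malcev_word; elim/big_ind: _ => // i _.
apply: (@subgroup_zexpg G (Gam 0)); first exact: malcev_sub_subgroup.
by apply: sub_generated; exists i.
Qed.

Lemma canonical_homM x y :
  canonical_hom a (x * y) = (canonical_hom a x + canonical_hom a y)%R.
Proof.
have [h hh ex] := canonical_hom_decomp x.
have [h' hh' ey] := canonical_hom_decomp y.
set z := canonical_hom a x in ex *; set z' := canonical_hom a y in ey *.
have -> : x * y = zexpg (a ord0) (z + z') * (h ^ (zexpg (a ord0) z') * h').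
  by rewrite ex ey zexpgD /conjg !mulgA mulgK.
apply: canonical_hom_unique; have [_ h2 _] := malcev_sub_subgroup 1.
by apply: h2 => //; exact: malcev_sub_conj.
Qed.

Lemma canonical_hom_zexpg z : canonical_hom a (zexpg (a ord0) z) = z.
Proof.
rewrite -[zexpg _ _]mulg1; apply: canonical_hom_unique.
by case: (malcev_sub_subgroup 1).
Qed.

End CanonicalHom.

(** * Normal form of skinny cocycles *)

Section Coboundaries.
Variable G : groupType.
Implicit Types (s : G -> G -> int) (k : G -> int).

Definition delta1 k (x y : G) : int := k y - k (x * y)%g + k x.

Lemma cocycle2B_delta1 s k : cocycle2 s ->
  cocycle2 (fun x y => s x y - delta1 k x y).
Proof.
by move=> hs x y z; rewrite -[RHS](hs x y z) /delta1 mulgA; ring.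
Qed.

Lemma cohomologous_torsion s s' :
  cohomologous s s' -> torsion_class s -> torsion_class s'.
Proof.
move=> [f hf] [n n0 [g hg]]; exists n => //; exists (fun x => g x - f x *+ n).
move=> x y _ _.
have -> : s' x y = s x y - (s x y - s' x y) by ring.
by rewrite mulrnBl hg // hf // mulrnDl mulrnBl; ring.
Qed.

End Coboundaries.

(** The vanishing of H^2(Z; Z), made explicit: the cochain is summed from its increments -c(z, 1),
    starting at [k 0 = 0]. *)
Lemma int_cocycle2_coboundary (c : int -> int -> int) :
  (forall x y z, c y z - c (x + y) z + c x (y + z) - c x y = 0) ->
  (forall x, c x 0 = 0) ->
  exists2 k : int -> int, k 0 = 0 & forall x y, c x y = k y - k (x + y) + k x.
Proof.
move=> hc c0.
pose k (z : int) := match z with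
  | Posz n => - \sum_(i < n) c i%:Z 1
  | Negz n => \sum_(i < n.+1) c (Negz i) 1 end.
have kS z : k (z + 1) = k z - c z 1.
  case: z => [n|[|n]].
  - by rewrite addrC -intS /= big_ord_recr /= opprD.
  - by rewrite /= big_ord0 big_ord1 subrr.
  have -> : (Negz n.+1 + 1)%R = Negz n by rewrite !NegzE !intS; ring.
  by rewrite /= [in RHS]big_ord_recr /= addrK.
have k0 : k 0 = 0 by rewrite /= big_ord0 oppr0.
have step x y : c x (y + 1) - (k (y + 1) - k (x + (y + 1)) + k x) =
    c x y - (k y - k (x + y) + k x).
  rewrite addrA !kS; have := hc x y 1.
  by move=> /eqP; rewrite subr_eq0 => /eqP <-; ring.
exists k => // x y; apply/eqP; rewrite -subr_eq0; apply/eqP.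
elim/int_rect: y => [|n IH|n IH]; first by rewrite c0 k0 addr0; ring.
  by rewrite intS (addrC 1 n%:Z) step.
by rewrite -step intS opprD (addrC (-1)) subrK.
Qed.

(** * Normalization and periodicity of skinny cocycles *)

Section SkinnyCocycles.
Variables (G : groupType) (alpha : G -> int) (t : G).
Hypothesis alphaM : forall x y, alpha (x * y)%g = alpha x + alpha y.
Hypothesis alphat : forall z, alpha (zexpg t z) = z.

Let alpha1 : alpha 1%g = 0.
Proof. by rewrite -(alphat 0). Qed.

Let decomp x : exists2 u, alpha u = 0 & x = (zexpg t (alpha x) * u)%g.
Proof.
exists (zexpg t (- alpha x) * x)%g; first by rewrite alphaM alphat addNr.
by rewrite mulgA -zexpgD subrr mul1g.
Qed.

(** Three successive coboundary corrections: by skinniness on the kernel, then on pairs (x, u) with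
    u in the kernel, then on powers of t. *)
Lemma skinny_normal_form sigma : cocycle2 sigma -> skinny alpha sigma ->
  exists tau, [/\ cocycle2 tau, cohomologous tau sigma,
    forall x u, alpha u = 0 -> tau x u = 0 &
    forall i j, tau (zexpg t i) (zexpg t j) = 0].
Proof.
move=> c0 [f hf].
pose g1 x := if alpha x == 0 then f x else 0.
pose s1 x y := sigma x y - delta1 g1 x y.
have c1 : cocycle2 s1 by exact: cocycle2B_delta1.
have s1N x y : alpha x = 0 -> alpha y = 0 -> s1 x y = 0.
  move=> hx hy; rewrite /s1 /delta1 /g1 alphaM hx hy addr0 eqxx hf //.
  by rewrite subrr.
(* With i = [alpha x], this choice removes the values at (t^i, u); the cocycle identity at (t^i,
   t^-i x, u) carries the vanishing over to (x, u). *)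
pose g2 x := - s1 (zexpg t (alpha x)) (zexpg t (- alpha x) * x)%g.
pose s2 x y := s1 x y - delta1 g2 x y.
have c2 : cocycle2 s2 by exact: cocycle2B_delta1.
have s2N x u : alpha u = 0 -> s2 x u = 0.
  move=> hu; have g2u : g2 u = 0.
    by rewrite /g2 hu oppr0 !zexpg0 mul1g s1N ?oppr0.
  rewrite /s2 /delta1 g2u /g2 alphaM hu addr0 mulgA.
  have := c1 (zexpg t (alpha x)) (zexpg t (- alpha x) * x)%g u.
  rewrite (s1N _ u) ?alphaM ?alphat ?addNr // !mulgA -zexpgD subrr zexpg0 mul1g.
  by move=> e; rewrite -[RHS]oppr0 -[X in _ = - X]e; ring.
have [x y z|z|k k0 hk] :=
  @int_cocycle2_coboundary (fun i j => s2 (zexpg t i) (zexpg t j)).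
- by rewrite !zexpgD; exact: c2.
- exact: s2N.
(* As [k 0 = 0], the coboundary of [k \o alpha] vanishes at (x, u) for u in the kernel, so the
   second normalization survives. *)
exists (fun x y => s2 x y - delta1 (k \o alpha) x y); split.
- exact: cocycle2B_delta1.
- exists (fun x => - (g1 x + g2 x + k (alpha x))) => x y _ _.
  by rewrite /s2 /s1 /delta1 /=; ring.
- by move=> x u hu; rewrite s2N // /delta1 /= alphaM hu k0 addr0; ring.
by move=> i j; rewrite hk /delta1 /= alphaM !alphat; ring.
Qed.

Variable tau : G -> G -> int.
Hypothesis tauC : cocycle2 tau.
Hypothesis tauN : forall x u, alpha u = 0 -> tau x u = 0.
Hypothesis taut : forall i j, tau (zexpg t i) (zexpg t j) = 0.

Lemma normal_form_alpha x y : tau x y = tau x (zexpg t (alpha y)).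
Proof.
have [u hu {1}->] := decomp y.
have := tauC x (zexpg t (alpha y)) u; rewrite !(tauN _ hu) subrr add0r.
by move/eqP; rewrite subr_eq0 => /eqP.
Qed.

Let F x j := tau x (zexpg t j).

Let FM x y j : F (x * y)%g j = F y j + F x (alpha y + j) - F x (alpha y).
Proof.
have := tauC x y (zexpg t j).
rewrite (normal_form_alpha x (y * _)%g) alphaM alphat (normal_form_alpha x y).
by move=> e; rewrite -[LHS]addr0 -e /F; ring.
Qed.

Let F0 x : F x 0 = 0.
Proof. exact: tauN. Qed.

Let FNM u v j : alpha v = 0 -> F (u * v)%g j = F v j + F u j.
Proof. by move=> hv; rewrite FM hv add0r F0 subr0. Qed.

Let Ft u i j : alpha u = 0 -> F (zexpg t i * u)%g j = F u j.
Proof. by move=> hu; rewrite FNM // /F taut addr0. Qed.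

Let c u := [~ u, t]%g.

Let alphaV x : alpha x^-1%g = - alpha x.
Proof. by apply/eqP; rewrite -addr_eq0 -alphaM mulVg alpha1. Qed.

Let alphac u : alpha (c u) = 0.
Proof. by rewrite /c commgEl /conjg !alphaM !alphaV; ring. Qed.

(** F(ut, j) is expanded in two ways, from the product u t and from u t = t u [u, t]. *)
Let FS u j : alpha u = 0 -> F u (1 + j) = F u 1 + F u j + F (c u) j.
Proof.
move=> hu; have t1 : alpha t = 1 by rewrite -[t]zexpg1 alphat.
have := FM u t j; rewrite t1.
have -> : F t j = 0 by rewrite -[t]zexpg1; exact: taut.
rewrite add0r conjgC -{1}[t]zexpg1 Ft; last first.
  by rewrite /conjg !alphaM alphaV hu; ring.
rewrite -(mulVKg u (u ^ t)%g) -commgEl FNM ?alphac // => e.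
by rewrite -/(c u) in e; rewrite -[LHS](subrK (F u 1)) -e; ring.
Qed.

(** Newton's forward difference formula: by [FS], differencing in k replaces u by its commutator
    with t up to a constant, and Pascal's rule gives the induction. Nilpotency truncates the sum at
    M. *)
Let F_binomial M u (k : nat) : alpha u = 0 ->
  (forall v, iter M c v = 1%g) ->
  F u k%:Z = \sum_(r < M) 'C(k, r.+1)%:R * F (iter r c u) 1.
Proof.
move=> + hM; elim: k u => [|k IHk] u hu.
  by rewrite F0 big1 // => r _; rewrite bin0n mul0r.
rewrite intS FS // !IHk //; pose f r := 'C(k, r)%:R * F (iter r c u) 1.
have e1 : \sum_(r < M.+1) f r =
    F u 1 + \sum_(r < M) 'C(k, r.+1)%:R * F (iter r c (c u)) 1.
  rewrite big_ord_recl /f bin0 mul1r; congr (_ + _).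
  by apply: eq_bigr => r _; rewrite -iterSr.
have F1 : F 1%g 1 = 0 by rewrite /F -(zexpg0 t); exact: taut.
have e2 : \sum_(r < M.+1) f r = \sum_(r < M) f r.
  by rewrite big_ord_recr /f /= hM F1 mulr0 addr0.
rewrite -addrA [\sum_(_ < _) _ + _]addrC addrA -e1 e2 -big_split /=.
by apply: eq_bigr => r _; rewrite /f binS natrD mulrDl addrC.
Qed.

(** The binomials C(p, r + 1) with r < M < p are divisible by p, so p divides F(u, p) for u in the
    kernel and hence F(y, p) for all y. Taking y = x t^i turns this into periodicity. *)
Lemma normal_form_periodic M p : prime p -> (M < p)%N ->
  (forall v, iter M c v = 1%g) -> forall x j j',
  (j = j' %[mod p%:Z])%Z ->
  (tau x (zexpg t j) = tau x (zexpg t j') %[mod p%:Z])%Z.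
Proof.
move=> pp Mp hM x j j' /eqP.
have FN u : alpha u = 0 -> (p%:Z %| F u p%:Z)%Z.
  move=> hu; rewrite (@F_binomial M u p hu hM); apply: rpred_sum => r _.
  apply: dvdz_mulr; rewrite natz; apply: prime_dvd_bin => //.
  by rewrite /= (leq_ltn_trans _ Mp).
have Fp y : (p%:Z %| F y p%:Z)%Z.
  by have [u hu ->] := decomp y; rewrite Ft // FN.
have FD i : (F x (i + p%:Z) = F x i %[mod p%:Z])%Z.
  apply/eqP; rewrite eqz_mod_dvd; have := Fp (x * zexpg t i)%g.
  by rewrite FM alphat /F taut add0r.
rewrite eqz_mod_dvd => /dvdzP[q hq].
have -> : j = j' + q * p%:Z by rewrite -hq addrC subrK.
rewrite -!/(F x _); elim/int_rect: q {hq} => [|n IH|n IH].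
  by rewrite mul0r addr0.
  by rewrite intS mulrDl mul1r addrCA addrC FD.
by rewrite -IH -[LHS]FD; congr (F x _ %% _)%Z; rewrite intS; ring.
Qed.

End SkinnyCocycles.

Lemma nilpotent_iter_comm (G : groupType) (t : G) : nilpotent_group G ->
  exists M, forall v, iter M (fun u => [~ u, t]%g) v = 1%g.
Proof.
move=> [M hM]; exists M => v.
have : lower_central M (iter M (fun u => [~ u, t]%g) v).
  elim: (M) => [//|k IHk] /=; have [_ _ h] := generated_subgroup
    [set z | exists x y, [/\ [set: G] x, lower_central k y & z = [~ x, y]%g]].
  (* [lower_central] puts the arbitrary element on the left, so [[~ u, t]] is the inverse of one of
     its generators. *)
  rewrite -invgR; apply: h; apply: sub_generated.
  by exists t, (iter k (fun u => [~ u, t]%g) v); split.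
by rewrite hM.
Qed.

(** * Instability *)

Lemma schatten0 (R : realType) (p : \bar R) n :
  (0 < p)%E -> schatten_norm p (0 : 'M[R[i]]_n) = 0.
Proof.
move=> p0; apply/eqP; rewrite eq_le schatten_ge0 // andbT.
have s0 : snorm (0 : R[i]) <= 0 ^+ 2 by rewrite snorm0 expr0n.
have := schatten_unitaryZ p0 (unitary1 R n) (lexx 0) s0.
by rewrite scale0r; case: (p) => [r||] //; rewrite mulr0.
Qed.

Section ShiftFamilies.
Variables (R : realType) (p : \bar R) (G : groupType).
Variables (alpha : G -> int) (s : int -> G) (tau : G -> G -> int) (N : set nat).
Hypothesis p1 : (1 < p)%E.
Hypothesis alphaM : forall x y, alpha (x * y)%g = alpha x + alpha y.
Hypothesis alphaK : cancel s alpha.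
Hypothesis tauC : cocycle2 tau.
Hypothesis tau_alpha : forall x y, tau x y = tau x (s (alpha y)).
Hypothesis N0 : forall n, N n -> (0 < n)%N.
Hypothesis tau_mod : forall n, N n -> forall x j j',
  (j = j' %[mod n%:Z])%Z -> (tau x (s j) = tau x (s j') %[mod n%:Z])%Z.

(** With [s] a section of [alpha], this covers both uses: powers of a_1 along primes for the failure
    of stability, and the polynomial cocycle for [rho_seq]. *)
Definition shift_family n x := shift_mx R n (alpha x) (fun j => tau x (s j)).

Lemma shift_family_unitary n : N n -> forall x, shift_family n x \is unitarymx.
Proof. by move=> Nn x; apply: shift_mx_unitary; exact: N0. Qed.

Lemma shift_family_mul n : N n -> forall x y,
  shift_family n x *m shift_family n y =
  expi (2 * pi / n%:R * (tau x y)%:~R) *: shift_family n (x * y)%g.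
Proof.
move=> Nn x y; apply: shift_mx_mul => [||j j'|j].
- exact: N0.
- exact: alphaM.
- exact: tau_mod.
have e := tauC x y (s j); rewrite (tau_alpha x (y * _)%g) alphaM alphaK in e.
rewrite (addrC j); apply/eqP; rewrite -subr_eq0 -[X in _ == X]e; apply/eqP.
ring.
Qed.

Lemma shift_family_asymptotic :
  asymptotic_rep p N (k := fun n => n) shift_family.
Proof.
exact: (projective_asymptotic p1 shift_family_unitary shift_family_mul).
Qed.

Lemma shift_family_torsion : (forall k, exists2 n, (k <= n)%N & N n) ->
  finitely_generated G -> perturbable p N (k := fun n => n) shift_family ->
  torsion_class tau.
Proof.
move=> Ninf [l hl] pert.
apply: (@torsion_of_real_coboundary R G tau _ (tnth (in_tuple l))).
  rewrite -hl; congr generated; apply/seteqP; split=> x /=.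
    by move=> [i _ <-]; exact: mem_tnth.
  by move=> xl; have /tnthP[i ->] : x \in in_tuple l by []; exists i.
move=> L; exact: (perturbable_real_coboundary p1 N0 shift_family_unitary
  shift_family_mul L Ninf pert).
Qed.

End ShiftFamilies.

Lemma not_stable_of_perturbable (R : realType) (p : \bar R) (G : groupType)
    (N : set nat) (rho : forall n, G -> 'M[R[i]]_n) : (0 < p)%E ->
  asymptotic_rep p N (k := fun n => n) rho -> stable p G ->
  perturbable p N (k := fun n => n) rho.
Proof.
move=> p0 [rhoU rhoM] st.
(* [stable] concerns sequences over all naturals; outside [N] the trivial representation fills the
   gaps with zero defect. *)
pose rho1 n x := if `[< N n >] then rho n x else 1%:M.
have rho1N n : N n -> rho1 n = rho n.
  by move=> Nn; apply/funext => x; rewrite /rho1 asboolT.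
have rho1C n x : ~ N n -> rho1 n x = 1%:M by move=> Nn; rewrite /rho1 asboolF.
have [|rho' hrep hcvg] := st (fun n => n) rho1.
  split=> [n _ x|x y].
    have [Nn|Nn] := pselect (N n); first by rewrite rho1N //; exact: rhoU.
    by rewrite rho1C //; exact: unitary1.
  apply/cvgrPdist_lt => e e0.
  have /cvgrPdist_lt/(_ _ e0)[n0 _ hn0] := rhoM x y.
  exists n0 => // n /= hn _.
  have [Nn|Nn] := pselect (N n); first by rewrite rho1N //; exact: hn0.
  by rewrite !rho1C // mulmx1 subrr schatten0 // subrr normr0.
exists rho'; first by move=> n _; exact: hrep.
move=> x; apply/cvgrPdist_lt => e e0.
have /cvgrPdist_lt/(_ _ e0)[n0 _ hn0] := hcvg x.
by exists n0 => // n /= hn Nn; have := hn0 n hn I; rewrite rho1N.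
Qed.

Section Denominators.
(* Membership in [msupp q] needs the eqType structure of multinomials. *)
Import (canonicals) mpoly.

Lemma coprime_to_denominators_infinite m (q : mpoly.mpoly m rat) k :
  exists2 n, (k <= n)%N & coprime_to_denominators q n.
Proof.
pose D := (\prod_(mu <- mpoly.msupp q) `|denq (mpoly.mcoeff mu q)|)%N.
have D0 : (0 < D)%N by rewrite prodn_gt0 // => mu; rewrite absz_gt0 denq_neq0.
(* This n is 1 modulo the product of all denominators of coefficients in the support, hence coprime
   to each. *)
exists (k * D).+1; first by rewrite ltnW // ltnS leq_pmulr.
split=> // mu; have [mu_q|mu_q] := boolP (mu \in mpoly.msupp q); last first.
  by rewrite mpoly.memN_msupp_eq0 // coprimen1.
have /dvdnP[e ->] : (`|denq (mpoly.mcoeff mu q)| %| D)%N.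
  by rewrite /D (big_rem mu) //= dvdn_mulr.
by rewrite coprime_sym mulnA /coprime -addn1 gcdnMDl gcdn1.
Qed.

End Denominators.

(** After multiplication by some D coprime to n the difference of values is divisible by n; as the
    difference is an integer, D can be cancelled. *)
Lemma poly_cocycle_mod (G : groupType) (m : nat) (a : 'I_m.+1 -> G)
    (tau : G -> G -> int) (q : mpoly.mpoly m.+2 rat) (n : nat) (x y y' : G) :
  (forall x y, (tau x y)%:~R =
     poly_eval q (malcev_coord a x) (canonical_hom a y)) ->
  coprime_to_denominators q n ->
  (canonical_hom a y = canonical_hom a y' %[mod n%:Z])%Z ->
  (tau x y = tau x y' %[mod n%:Z])%Z.
Proof.
move=> htau hn hj.
have [D [c [cD eD]]] := poly_eval_mod (malcev_coord a x) hn hj.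
apply/eqP; rewrite eqz_mod_dvd.
have : (n%:Z %| D%:Z * (tau x y - tau x y'))%Z.
  apply/dvdzP; exists c; apply: (@intr_inj rat).
  by rewrite !rmorphM rmorphB /= -!pmulrn !htau eD mulrC.
by rewrite Gauss_dvdzr // coprimezE.
Qed.

Unset Implicit Arguments.

Theorem theorem4p4 (R : realType) (p : \bar R) (G : groupType) (m : nat)
    (a : 'I_m.+1 -> G) (sigma : G -> G -> int) :
  (1 < p)%E ->
  finitely_generated G -> torsion_free G -> nilpotent_group G ->
  malcev_basis a ->
  cocycle2 sigma -> ~ torsion_class sigma -> skinny (canonical_hom a) sigma ->
  ~ stable p G /\
  forall (tau : G -> G -> int) (q : mpoly.mpoly m.+2 rat),
    cocycle2 tau -> cohomologous tau sigma ->
    (forall x y : G, (tau x y)%:~R =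
       poly_eval q (malcev_coord a x) (canonical_hom a y)) ->
    asymptotic_rep p (coprime_to_denominators q) (k := fun n => n)
      (rho_seq R a q) /\
    ~ perturbable p (coprime_to_denominators q) (k := fun n => n)
      (rho_seq R a q).
Proof.
move=> p1 fg _ nil ha sigmaC ntor sk.
have p0 : (0 < p)%E by apply: lt_trans p1; rewrite lte01.
have alphaM := canonical_homM ha; have alphat := canonical_hom_zexpg ha.
split=> [st|tau q tauC cob htau].
  (* No polynomial is given in this half, so periodicity comes from the normal form, along the
     primes exceeding the length M of vanishing iterated commutators with a_1. *)
  have [tau [tauC cob tauN taut]] := skinny_normal_form alphaM alphat sigmaC sk.
  apply: ntor; apply: (cohomologous_torsion cob).
  have [M hM] := nilpotent_iter_comm (a ord0) nil.
  pose N : set nat := [set n | prime n /\ (M < n)%N].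
  have N0 n : N n -> (0 < n)%N by case=> /prime_gt0.
  have tauA := normal_form_alpha alphaM alphat tauC tauN.
  have tauP n : N n -> forall x j j', (j = j' %[mod n%:Z])%Z ->
    (tau x (zexpg (a ord0) j) = tau x (zexpg (a ord0) j') %[mod n%:Z])%Z.
    case=> pn Mn x j j'.
    exact: (normal_form_periodic alphaM alphat tauC tauN taut pn Mn hM).
  apply: (shift_family_torsion p1 alphaM alphat tauC tauA N0 tauP) => //.
    move=> k; have [n kn pn] := prime_above (k + M).
    exists n; first by rewrite (leq_trans _ (ltnW kn)) ?leq_addr.
    by split=> //; rewrite (leq_ltn_trans _ kn) ?leq_addl.
  apply: not_stable_of_perturbable st => //.
  exact: (shift_family_asymptotic p1 alphaM alphat tauC tauA N0 tauP).
(* Any section of [canonical_hom] would serve; only the first of the equal coordinates matters. *)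
pose s j := malcev_word a [ffun=> j].
have alphaK : cancel s (canonical_hom a).
  by move=> j; rewrite /canonical_hom malcev_coordK // ffunE.
have N0 n : coprime_to_denominators q n -> (0 < n)%N by case.
have tauA x y : tau x y = tau x (s (canonical_hom a y)).
  by apply: (@intr_inj rat); rewrite !htau alphaK.
have tauP n : coprime_to_denominators q n -> forall x j j',
    (j = j' %[mod n%:Z])%Z -> (tau x (s j) = tau x (s j') %[mod n%:Z])%Z.
  move=> hn x j j' e; apply: (@poly_cocycle_mod G m a tau q n x _ _ htau hn).
  by rewrite !alphaK.
have -> : rho_seq R a q = shift_family R (canonical_hom a) s tau.
  apply: functional_extensionality_dep => n; apply/funext => x.
  apply/matrixP => i j; rewrite !mxE.
  by case: ifP => // _; rewrite -(ratr_int R) htau alphaK.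
split.
  exact: (shift_family_asymptotic p1 alphaM alphaK tauC tauA N0 tauP).
move=> pert; apply: ntor; apply: (cohomologous_torsion cob).
apply: (shift_family_torsion p1 alphaM alphaK tauC tauA N0 tauP) pert => // k.
exact: coprime_to_denominators_infinite.
Qed.
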